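(* Let $H$ be a cocommutative Hopf algebra over $\mathbb C$ and let $A$ be an $H$-module algebra. Let $\widehat H$ be the Arens-Michael envelope of $H$, let $\widetilde A$ be the $H$-completion of $A$, and let $\widetilde A\,\widehat{\#}\,\widehat H$ be their analytic smash product. Then the canonical map $A\# H\to\widetilde A\,\widehat{\#}\,\widehat H$ extends to an isomorphism of $\widehat\otimes$-algebras $$\widehat{A\# H}\;\cong\;\widetilde A\,\widehat{\#}\,\widehat H,$$ where $\widehat{A\# H}$ denotes the Arens-Michael envelope of the smash product algebra $A\# H$.
   Context: All vector spaces and algebras are over $\mathbb C$; associative algebras are unital. A $\widehat\otimes$-algebra is a complete Hausdorff locally convex topological algebra with jointly continuous multiplication; $\widehat\otimes$ is the completed projective tensor product. $\widehat\otimes$-coalgebras, $\widehat\otimes$-bialgebras, etc. are the corresponding objects in the tensor category of complete Hausdorff locally convex spaces with $\widehat\otimes$. A $\widehat\otimes$-module over a $\widehat\otimes$-algebra is a complete Hausdorff locally convex unital module with jointly continuous action. A seminorm on an algebra is submultiplicative if $\|ab\|\le\|a\|\|b\|$. An Arens-Michael algebra is a complete Hausdorff topological algebra whose topology is defined by submultiplicative seminorms. The Arens-Michael envelope $\widehat A$ of an algebra $A$ is the completion of $A$ with respect to all submultiplicative seminorms (the completion of a non-Hausdorff locally convex space $E$ is that of $E/\overline{\{0\}}$), with canonical homomorphism $\iota_A\colon A\to\widehat A$. It has the universal property that every homomorphism $\varphi$ from $A$ to an Arens-Michael algebra $B$ factors as $\varphi=\widehat\varphi\,\iota_A$ for a unique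 continuous homomorphism $\widehat\varphi\colon\widehat A\to B$; one says $\widehat\varphi$ extends $\varphi$. If $H$ is a bialgebra, $\widehat H$ is a $\widehat\otimes$-bialgebra, with comultiplication and counit extending those of $H$. An $H$-module algebra is an algebra $A$ with a left $H$-module structure such that the product $A\otimes A\to A$ and the unit $\mathbb C\to A$ are $H$-module morphisms ($H$-$\widehat\otimes$-module algebras over a $\widehat\otimes$-bialgebra are defined likewise with $\widehat\otimes$-algebras and $\widehat\otimes$-modules). The smash product $A\# H$ is $A\otimes H$ with multiplication $(\mu_A\otimes\mu_H)(1_A\otimes\tau\otimes1_H)$, where $\tau\colon H\otimes A\to A\otimes H$, $\tau=(\mu_{H,A}\otimes 1_H)(1_H\otimes c_{H,A})(\Delta_H\otimes1_A)$, $\mu_{H,A}\colon H\otimes A\to A$ is the action, $c_{H,A}$ is the flip; i.e. $(a\otimes h)(b\otimes k)=\sum a(h_{(1)}\cdot b)\otimes h_{(2)}k$. For a $\widehat\otimes$-bialgebra $H$ and an $H$-$\widehat\otimes$-module algebra $A$, the analytic smash product $A\,\widehat{\#}\,H$ is the locally convex space $A\widehat\otimes H$ with multiplication defined by the same formulas with $\otimes$ replaced by $\widehat\otimes$; it is a $\widehat\otimes$-algebra. A seminorm $\|\cdot\|$ on an $H$-module $E$ is $H$-stable if for each $h\in H$ there is $C>0$ with $\|h\cdot x\|\le C\|x\|$ for all $x\in E$. The $H$-completion $\widetilde A$ of an $H$-module algebra $A$ is the completion of $A$ with respect to the family of all $H$-stable submultiplicative seminorms on $A$. The action of $H$ on $A$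 extends uniquely to an action of $\widehat H$ on $\widetilde A$ making $\widetilde A$ an $\widehat H$-$\widehat\otimes$-module algebra, and the resulting $\widehat\otimes$-algebra $\widetilde A\,\widehat{\#}\,\widehat H$ is an Arens-Michael algebra. The canonical map $A\# H\to\widetilde A\,\widehat{\#}\,\widehat H$ is the tensor product of the canonical maps $A\to\widetilde A$ and $H\to\widehat H$. *)

(* Defs.v *)
From HB Require Import structures.
From mathcomp Require Import all_boot all_order all_algebra.
From mathcomp Require Import generic_quotient sesquilinear complex.
From mathcomp Require Import all_classical all_reals all_analysis.

Set Implicit Arguments.
Unset Strict Implicit.
Unset Printing Implicit Defensive.

Import Order.TTheory GRing.Theory Num.Theory.
Import numFieldNormedType.Exports.

Local Open Scope classical_set_scope.
Local Open Scope ring_scope.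
Local Open Scope complex_scope.
Local Open Scope quotient_scope.

Notation bilin f := (bilinear_for *:%R *:%R f).

(* The algebraic tensor product: formal sums of pairs modulo the bilinearity
   relations. *)
Inductive tensor_eq (K : comNzRingType) (U V : lmodType K) :
    seq (U * V) -> seq (U * V) -> Prop :=
| teq_refl s : tensor_eq s s
| teq_sym s t : tensor_eq s t -> tensor_eq t s
| teq_trans t s u : tensor_eq s t -> tensor_eq t u -> tensor_eq s u
| teq_catC s t : tensor_eq (s ++ t) (t ++ s)
| teq_catl s s' t : tensor_eq s s' -> tensor_eq (s ++ t) (s' ++ t)
| teq_0 v : tensor_eq [:: (0, v)] [::]
| teq_Dl x y v : tensor_eq [:: (x + y, v)] [:: (x, v); (y, v)]
| teq_Dr x v w : tensor_eq [:: (x, v + w)] [:: (x, v); (x, w)]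
| teq_Z c x v : tensor_eq [:: (c *: x, v)] [:: (x, c *: v)].

Section TensorType.
Variables (K : comNzRingType) (U V : lmodType K).

Definition tensor_rel (s t : seq (U * V)) : bool := `[< tensor_eq s t >].

Fact tensor_rel_refl : reflexive tensor_rel.
Proof. by move=> s; apply/asboolP; exact: teq_refl. Qed.

Fact tensor_rel_sym : symmetric tensor_rel.
Proof. by move=> s t; apply/asboolP/asboolP => /teq_sym. Qed.

Fact tensor_rel_trans : transitive tensor_rel.
Proof.
by move=> t s u /asboolP st /asboolP tu; apply/asboolP; exact: teq_trans st tu.
Qed.

Canonical tensor_equiv :=
  EquivRel tensor_rel tensor_rel_refl tensor_rel_sym tensor_rel_trans.

Definition tensor := {eq_quot tensor_equiv}.

HB.instance Definition _ := Choice.on tensor.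
HB.instance Definition _ : EqQuotient _ tensor_equiv tensor :=
  EqQuotient.on tensor.

Lemma tensorW (P : tensor -> Prop) :
  (forall s, P (\pi_tensor s)) -> forall u, P u.
Proof. by move=> Ps u; rewrite -[u]reprK. Qed.

Lemma tensorP (s t : seq (U * V)) :
  \pi_tensor s = \pi_tensor t <-> tensor_eq s t.
Proof.
split=> [/eqmodP/asboolP //|st]; apply/eqmodP; exact/asboolP.
Qed.

Lemma tensor_repr s : tensor_eq (repr (\pi_tensor s)) s.
Proof. by apply/tensorP; rewrite reprK. Qed.

Lemma teq_cat s s' t t' : tensor_eq s s' -> tensor_eq t t' ->
  @tensor_eq K U V (s ++ t) (s' ++ t').
Proof.
move=> ss' tt'; apply: (teq_trans (teq_catl t ss')).
apply: (teq_trans (teq_catC _ _)); apply: (teq_trans (teq_catl s' tt')).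
exact: teq_catC.
Qed.

Definition tscale (c : K) (s : seq (U * V)) := [seq (c *: x.1, x.2) | x <- s].

Lemma teq_scale c s t : tensor_eq s t -> tensor_eq (tscale c s) (tscale c t).
Proof.
elim=> {s t} [s|s t _|t s u _ + _|s t|s s' t _|v|x y v|x v w|d x v] /=.
- exact: teq_refl.
- exact: teq_sym.
- exact: teq_trans.
- by rewrite /tscale !map_cat; exact: teq_catC.
- by move=> h; rewrite /tscale !map_cat; exact: teq_catl.
- by rewrite scaler0; exact: teq_0.
- by rewrite scalerDr; exact: teq_Dl.
- exact: teq_Dr.
- by rewrite scalerA mulrC -scalerA; exact: teq_Z.
Qed.

Lemma teq_catCA s t u : @tensor_eq K U V (s ++ t ++ u) (t ++ s ++ u).
Proof. by rewrite !catA; apply: teq_catl; exact: teq_catC. Qed.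

Lemma tscaleDl c d s : tensor_eq (tscale (c + d) s) (tscale c s ++ tscale d s).
Proof.
elim: s => [|[x v] s ih] /=; first exact: teq_refl.
rewrite scalerDl -cat1s; apply: (teq_trans (teq_cat (teq_Dl _ _ _) ih)).
apply: (@teq_cat [:: _] [:: _] ([:: _] ++ _)); first exact: teq_refl.
exact: (teq_catCA [:: _]).
Qed.

Lemma tscale0 s : tensor_eq (tscale 0 s) [::].
Proof.
elim: s => [|[x v] s ih] /=; first exact: teq_refl.
by rewrite scale0r; exact: (@teq_cat [:: _] [::] _ [::] (teq_0 U v) ih).
Qed.

Lemma tscaleA c d s : tscale c (tscale d s) = tscale (c * d) s.
Proof. by rewrite /tscale -map_comp; apply: eq_map => x /=; rewrite scalerA. Qed.

Lemma tscale1 s : tscale 1 s = s.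
Proof. by rewrite /tscale -[RHS]map_id; apply: eq_map => -[x v] /=; rewrite scale1r. Qed.

Definition tensor_add (u v : tensor) : tensor := \pi_tensor (repr u ++ repr v).
Definition tensor_zero : tensor := \pi_tensor [::].
Definition tensor_scale (c : K) (u : tensor) : tensor :=
  \pi_tensor (tscale c (repr u)).

Lemma pi_tensor_add s t :
  tensor_add (\pi_tensor s) (\pi_tensor t) = \pi_tensor (s ++ t).
Proof. by apply/tensorP; apply: teq_cat; exact: tensor_repr. Qed.

Lemma pi_tensor_scale c s :
  tensor_scale c (\pi_tensor s) = \pi_tensor (tscale c s).
Proof. by apply/tensorP; apply: teq_scale; exact: tensor_repr. Qed.

Fact tensor_addA : associative tensor_add.
Proof.
move=> u v w; elim/tensorW: u => s; elim/tensorW: v => t; elim/tensorW: w => u.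
by rewrite !pi_tensor_add catA.
Qed.

Fact tensor_addC : commutative tensor_add.
Proof.
move=> u v; elim/tensorW: u => s; elim/tensorW: v => t; rewrite !pi_tensor_add.
by apply/tensorP; exact: teq_catC.
Qed.

Fact tensor_add0 : left_id tensor_zero tensor_add.
Proof. by move=> u; elim/tensorW: u => s; rewrite pi_tensor_add. Qed.

Fact tensor_addN : left_inverse tensor_zero (tensor_scale (-1)) tensor_add.
Proof.
move=> u; elim/tensorW: u => s; rewrite pi_tensor_scale pi_tensor_add; apply/tensorP.
rewrite -[s in _ ++ s]tscale1; apply: teq_trans (tscale0 s).
by apply: teq_sym; rewrite -[X in tscale X s](addNr 1); exact: tscaleDl.
Qed.

HB.instance Definition _ := GRing.isZmodule.Build tensor
  tensor_addA tensor_addC tensor_add0 tensor_addN.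

Fact tensor_scaleA c d (u : tensor) :
  tensor_scale c (tensor_scale d u) = tensor_scale (c * d) u.
Proof. by elim/tensorW: u => s; rewrite !pi_tensor_scale tscaleA. Qed.

Fact tensor_scale1 : left_id 1 tensor_scale.
Proof. by move=> u; elim/tensorW: u => s; rewrite pi_tensor_scale tscale1. Qed.

Fact tensor_scaleDr : right_distributive tensor_scale +%R.
Proof.
move=> c u v; elim/tensorW: u => s; elim/tensorW: v => t.
rewrite -![_ + _]/(tensor_add _ _) pi_tensor_add !pi_tensor_scale pi_tensor_add.
by rewrite /tscale map_cat.
Qed.

Fact tensor_scaleDl (u : tensor) :
  {morph tensor_scale^~ u : c d / c + d}.
Proof.
elim/tensorW: u => s c d.
rewrite !pi_tensor_scale -[X in _ = X]/(tensor_add _ _) pi_tensor_add.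
by apply/tensorP; exact: tscaleDl.
Qed.

HB.instance Definition _ := GRing.Zmodule_isLmodule.Build K tensor
  tensor_scaleA tensor_scale1 tensor_scaleDr tensor_scaleDl.

Definition tens (x : U) (v : V) : tensor := \pi_tensor [:: (x, v)].

Lemma tens_bilin : bilin tens.
Proof.
split=> [v|x] c y z; rewrite /tens.
  rewrite -[RHS]/(tensor_add (tensor_scale _ _) _) pi_tensor_scale pi_tensor_add.
  by apply/tensorP; exact: teq_Dl.
rewrite -[RHS]/(tensor_add (tensor_scale _ _) _) pi_tensor_scale pi_tensor_add.
apply/tensorP; apply: (teq_trans (teq_Dr _ _ _)) => /=.
rewrite -cat1s -[X in tensor_eq _ X]cat1s; apply: teq_catl.
exact/teq_sym/teq_Z.
Qed.

Lemma pi_tensor_sum s : \pi_tensor s = \sum_(x <- s) tens x.1 x.2.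
Proof.
elim: s => [|[x v] s ih]; first by rewrite big_nil.
by rewrite big_cons -ih -[RHS]/(tensor_add _ _) pi_tensor_add.
Qed.

(* tlift f u is the sum of the f x_i v_i for any representation
   u = \sum_i tens x_i v_i when f is bilinear; unspecified otherwise. *)
Definition tlift (W : lmodType K) (f : U -> V -> W) (u : tensor) : W :=
  \sum_(x <- repr u) f x.1 x.2.

Lemma tensorE (u : tensor) : u = tlift tens u.
Proof. by rewrite /tlift -pi_tensor_sum reprK. Qed.

Section Lift.
Variables (W : lmodType K) (f : U -> V -> W).
Hypothesis fb : bilin f.

Lemma bilinDl x y v : f (x + y) v = f x v + f y v.
Proof. by have /= := fb.1 v 1 x y; rewrite !scale1r. Qed.
Lemma bilinDr x v w : f x (v + w) = f x v + f x w.
Proof. by have /= := fb.2 x 1 v w; rewrite !scale1r. Qed.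
Lemma bilin0l v : f 0 v = 0.
Proof. by apply: (addIr (f 0 v)); rewrite -bilinDl addr0 add0r. Qed.
Lemma bilin0r x : f x 0 = 0.
Proof. by apply: (addIr (f x 0)); rewrite -bilinDr addr0 add0r. Qed.
Lemma bilinZl c x v : f (c *: x) v = c *: f x v.
Proof. by have /= := fb.1 v c x 0; rewrite bilin0l !addr0. Qed.
Lemma bilinZr c x v : f x (c *: v) = c *: f x v.
Proof. by have /= := fb.2 x c v 0; rewrite bilin0r !addr0. Qed.

Lemma teq_sum s t : tensor_eq s t ->
  \sum_(x <- s) f x.1 x.2 = \sum_(x <- t) f x.1 x.2.
Proof.
elim=> {s t} [//|s t _ -> //|t s u _ -> _ -> //|s t|s s' t _|v|x y v|x v w|d x v].
- by rewrite !big_cat /= addrC.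
- by rewrite !big_cat /= => ->.
- by rewrite big_seq1 big_nil bilin0l.
- by rewrite !big_cons !big_nil !addr0 bilinDl.
- by rewrite !big_cons !big_nil !addr0 bilinDr.
- by rewrite !big_seq1 /= bilinZl bilinZr.
Qed.

Lemma tlift_pi s : tlift f (\pi_tensor s) = \sum_(x <- s) f x.1 x.2.
Proof. by apply: teq_sum; exact: tensor_repr. Qed.

Lemma tlift_tens x v : tlift f (tens x v) = f x v.
Proof. by rewrite tlift_pi big_seq1. Qed.

Lemma tlift_linear : linear (tlift f).
Proof.
move=> c u v; elim/tensorW: u => s; elim/tensorW: v => t.
rewrite [_ + _](_ : _ = \pi_tensor (tscale c s ++ t)); last first.
  by rewrite -pi_tensor_add -pi_tensor_scale.
rewrite !tlift_pi big_cat /= big_map scaler_sumr; congr (_ + _).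
by apply: eq_bigr => x _; rewrite bilinZl.
Qed.

Lemma tlift_unique (g : tensor -> W) : linear g ->
  (forall x v, g (tens x v) = f x v) -> g = tlift f.
Proof.
move=> gl gE; pose g' := HB.pack_for {linear tensor -> W} g
  (GRing.isLinear.Build _ _ _ _ g gl).
apply/funext => u; rewrite [in LHS](tensorE u) /tlift -[g]/(g' : _ -> _).
by rewrite linear_sum /=; apply: eq_bigr => x _; exact: gE.
Qed.

End Lift.
End TensorType.
Arguments tens {K U V}.

Section TensorTheory.
Variables (K : comNzRingType) (U V : lmodType K).

Lemma eq_tlift (W : lmodType K) (f g : U -> V -> W) (u : tensor U V) :
  (forall x v, f x v = g x v) -> tlift f u = tlift g u.
Proof. by move=> fg; apply: eq_bigr => x _; exact: fg. Qed.

Lemma tliftP (W : lmodType K) c (f g : U -> V -> W) (u : tensor U V) :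
  tlift (fun x v => c *: f x v + g x v) u = c *: tlift f u + tlift g u.
Proof. by rewrite /tlift big_split scaler_sumr. Qed.

Lemma linear_tlift (W W' : lmodType K) (g : W -> W') (f : U -> V -> W)
    (u : tensor U V) :
  linear g -> g (tlift f u) = tlift (fun x v => g (f x v)) u.
Proof.
move=> gl; pose g' := HB.pack_for {linear W -> W'} g
  (GRing.isLinear.Build _ _ _ _ g gl).
by rewrite -[g]/(g' : _ -> _) /tlift linear_sum.
Qed.

Lemma exchange_tlift (U' V' W : lmodType K) (f : U -> V -> U' -> V' -> W) u u' :
  tlift (fun x v => tlift (fun y w => f x v y w) u') u =
  tlift (fun y w => tlift (fun x v => f x v y w) u) u'.
Proof. exact: exchange_big. Qed.

Lemma eq_linear_tens (W : lmodType K) (f g : tensor U V -> W) :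
  linear f -> linear g -> (forall x v, f (tens x v) = g (tens x v)) -> f =1 g.
Proof.
move=> fl gl fg u.
by rewrite (tensorE u) (linear_tlift _ _ fl) (linear_tlift _ _ gl); exact: eq_tlift.
Qed.

End TensorTheory.

(* Unital associative algebras in which 1 = 0 is allowed, unlike in algType: a
   completion of a nonzero algebra may be zero (when all the seminorms of the
   family vanish). *)
HB.mixin Record isUAlg (K : comNzRingType) A of GRing.Lmodule K A := {
  amul : A -> A -> A;
  aone : A;
  amulA : associative amul;
  amul1l : left_id aone amul;
  amul1r : right_id aone amul;
  amul_bilin : bilin amul
}.

#[short(type="uAlgType")]
HB.structure Definition UAlg (K : comNzRingType) :=
  {A of isUAlg K A & GRing.Lmodule K A}.

Notation "x ** y" := (amul x y) (at level 40, left associativity) : ring_scope.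
Notation "\1" := aone : ring_scope.

Section UAlgTheory.
Variables (K : comNzRingType) (A : uAlgType K).

Lemma amul_linl c (x y z : A) : (c *: x + y) ** z = c *: (x ** z) + y ** z.
Proof. exact: amul_bilin.1. Qed.

Lemma amul_linr c (x y z : A) : x ** (c *: y + z) = c *: (x ** y) + x ** z.
Proof. exact: amul_bilin.2. Qed.

End UAlgTheory.

HB.mixin Record isBialg (K : comNzRingType) H of UAlg K H := {
  comul : H -> tensor H H;
  counit : H -> K;
  comul_linear : linear comul;
  counit_linear : linear_for *%R counit;
  comul_coassoc : forall h : H,
    tlift (fun x y => tlift (fun u v => tens u (tens v y)) (comul x)) (comul h)
    = tlift (fun x y => tens x (comul y)) (comul h);
  comul_counitl : forall h : H,
    tlift (fun x y => counit x *: y) (comul h) = h;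
  comul_counitr : forall h : H,
    tlift (fun x y => counit y *: x) (comul h) = h;
  comul1 : comul \1 = tens \1 \1;
  comulM : forall h k : H, comul (h ** k) =
    tlift (fun x y => tlift (fun u v => tens (x ** u) (y ** v)) (comul k))
      (comul h);
  counit1 : counit \1 = 1;
  counitM : forall h k : H, counit (h ** k) = counit h * counit k
}.

#[short(type="bialgType")]
HB.structure Definition Bialg (K : comNzRingType) :=
  {H of isBialg K H & UAlg K H}.

HB.mixin Record isHopf (K : comNzRingType) H of Bialg K H := {
  antipode : H -> H;
  antipode_linear : linear antipode;
  antipodel : forall h : H,
    tlift (fun x y => antipode x ** y) (comul h) = counit h *: \1;
  antipoder : forall h : H,
    tlift (fun x y => x ** antipode y) (comul h) = counit h *: \1
}.

#[short(type="hopfType")]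
HB.structure Definition Hopf (K : comNzRingType) :=
  {H of isHopf K H & Bialg K H}.

Definition cocommutative (K : comNzRingType) (H : bialgType K) :=
  forall h : H, tlift (fun x y => tens y x) (comul h) = comul h.

HB.mixin Record isModuleAlg (K : comNzRingType) (H : bialgType K) A
    of UAlg K A := {
  hact : H -> A -> A;
  hact_bilin : bilin hact;
  hact1 : forall a : A, hact \1 a = a;
  hactM : forall (h k : H) (a : A), hact (h ** k) a = hact h (hact k a);
  hact_mul : forall (h : H) (a b : A),
    hact h (a ** b) = tlift (fun x y => hact x a ** hact y b) (comul h);
  hact_one : forall h : H, hact h \1 = counit h *: (\1 : A)
}.

#[short(type="moduleAlgType")]
HB.structure Definition ModuleAlg (K : comNzRingType) (H : bialgType K) :=
  {A of isModuleAlg K H A & UAlg K A}.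

Definition smash (K : comNzRingType) (H : bialgType K) (A : moduleAlgType H) :
  Type := tensor A H.

Section Smash.
Variables (K : comNzRingType) (H : bialgType K) (A : moduleAlgType H).
Local Notation S := (smash A).

HB.instance Definition _ := GRing.Lmodule.on S.

Definition smash_mul (u v : S) : S :=
  tlift (fun a h => tlift (fun b k =>
    tlift (fun x y => tens (a ** hact x b) (y ** k)) (comul h)) v) u.
Definition smash_one : S := tens \1 \1.

Let G a h b k : S :=
  tlift (fun x y => tens (a ** hact x b) (y ** k)) (comul h).

Let Gin a b k : bilin (fun x y => tens (a ** hact x b) (y ** k) : S).
Proof.
split=> [y|x] c u v.
  rewrite (hact_bilin.1 b) amul_linr; exact: (tens_bilin _ _).1.
rewrite amul_linl; exact: (tens_bilin _ _).2.
Qed.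

Let Gbk a h : bilin (G a h).
Proof.
split=> [k|b] c u v; rewrite -tliftP; apply: eq_tlift => x y.
  rewrite (hact_bilin.2 x) amul_linr; exact: (tens_bilin _ _).1.
rewrite amul_linr; exact: (tens_bilin _ _).2.
Qed.

Let Gah b k : bilin (fun a h => G a h b k).
Proof.
split=> [h|a] c u v.
  rewrite -tliftP; apply: eq_tlift => x y.
  rewrite amul_linl; exact: (tens_bilin _ _).1.
rewrite /G comul_linear; exact: (tlift_linear (Gin _ _ _)).
Qed.

Let Gv v : bilin (fun a h => tlift (G a h) v).
Proof.
split=> [h|a] c u w; rewrite -tliftP; apply: eq_tlift => b k.
  exact: (Gah b k).1.
exact: (Gah b k).2.
Qed.

Lemma smash_mulE a h b k : smash_mul (tens a h) (tens b k) =
  tlift (fun x y => tens (a ** hact x b) (y ** k)) (comul h).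
Proof. by rewrite /smash_mul (tlift_tens (Gv _)) (tlift_tens (Gbk _ _)). Qed.

Lemma smash_mul_bilin : bilin smash_mul.
Proof.
split=> [v|u]; first exact: (tlift_linear (Gv v)).
move=> c v w; rewrite /smash_mul -tliftP; apply: eq_tlift => a h.
exact: (tlift_linear (Gbk a h)).
Qed.

Let coassoc3 (W : lmodType K) (w : H -> H -> H -> W) h :
  (forall y z, linear (fun x => w x y z)) ->
  (forall x z, linear (fun y => w x y z)) ->
  (forall x y, linear (w x y)) ->
  tlift (fun x y => tlift (fun u v => w u v y) (comul x)) (comul h) =
  tlift (fun x y => tlift (fun u v => w x u v) (comul y)) (comul h).
Proof.
move=> w1 w2 w3.
have wb x : bilin (w x) by split=> [z|y]; [exact: w2|exact: w3].
have wt : bilin (fun x u => tlift (w x) u).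
  split=> [u|x]; last exact: (tlift_linear (wb x)).
  by move=> c x y; rewrite -tliftP; apply: eq_tlift => a b; exact: w1.
have /(congr1 (tlift (fun x u => tlift (w x) u))) := comul_coassoc h.
rewrite !(linear_tlift _ _ (tlift_linear wt)) => e.
transitivity (tlift (fun x y => tlift (fun u => tlift (w u))
    (tlift (fun u v => tens u (tens v y)) (comul x))) (comul h)).
  apply: eq_tlift => x y; rewrite (linear_tlift _ _ (tlift_linear wt)).
  by apply: eq_tlift => u v; rewrite (tlift_tens wt) (tlift_tens (wb _)).
by rewrite e; apply: eq_tlift => x y; rewrite (tlift_tens wt).
Qed.

Let linear_mull (u : S) : linear (smash_mul u).
Proof. exact: smash_mul_bilin.2. Qed.
Let linear_mulr (v : S) : linear (smash_mul^~ v).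
Proof. exact: smash_mul_bilin.1. Qed.

Fact smash_mulA : associative smash_mul.
Proof.
have lin_comp (X Y Z : lmodType K) (f : X -> Y) (g : Y -> Z) :
    linear f -> linear g -> linear (fun x => g (f x)).
  by move=> fl gl c x y; rewrite fl gl.
move=> u v w; move: u; apply: eq_linear_tens => [|| a h].
- exact: linear_mulr.
- by apply: (lin_comp _ _ _ (smash_mul^~ v)); exact: linear_mulr.
move: v; apply: eq_linear_tens => [|| b k].
- by apply: (lin_comp _ _ _ (smash_mul^~ w)); [exact: linear_mulr|exact: linear_mull].
- by apply: (lin_comp _ _ _ (smash_mul (tens a h)));
    [exact: linear_mull|exact: linear_mulr].
move: w; apply: eq_linear_tens => [|| c l].
- by apply: (lin_comp _ _ _ (smash_mul (tens b k))); exact: linear_mull.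
- exact: linear_mull.
rewrite !smash_mulE (linear_tlift _ _ (linear_mull _)).
rewrite (linear_tlift _ _ (linear_mulr (tens c l))).
pose w x y z : S :=
  tlift (fun p q => tens (a ** hact x b ** hact y (hact p c)) (z ** (q ** l)))
    (comul k).
transitivity
  (tlift (fun x y => tlift (fun u v => w u v y) (comul x)) (comul h)).
  under eq_tlift => p q do rewrite smash_mulE.
  rewrite exchange_tlift; apply: eq_tlift => x y.
  rewrite exchange_tlift; apply: eq_tlift => p q.
  rewrite hact_mul.
  have l1 : linear (fun d : A => tens (a ** d) (y ** (q ** l)) : S).
    by move=> e d d'; rewrite amul_linr; exact: (tens_bilin _ _).1.
  rewrite (linear_tlift _ _ l1); apply: eq_tlift => u v.
  by rewrite (amulA a).
rewrite coassoc3; last 3 first.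
- move=> y z e d d'; rewrite -tliftP; apply: eq_tlift => p q.
  rewrite (hact_bilin.1 b) amul_linr amul_linl.
  exact: (tens_bilin _ _).1.
- move=> y z e d d'; rewrite -tliftP; apply: eq_tlift => p q.
  rewrite (hact_bilin.1 (hact p c)) amul_linr.
  exact: (tens_bilin _ _).1.
- move=> y z e d d'; rewrite -tliftP; apply: eq_tlift => p q.
  rewrite amul_linl; exact: (tens_bilin _ _).2.
apply: eq_tlift => x y; rewrite smash_mulE comulM.
have Gb := Gin (a ** hact x b) c l.
rewrite (linear_tlift _ _ (tlift_linear Gb)); apply: eq_tlift => u v.
rewrite (linear_tlift _ _ (tlift_linear Gb)); apply: eq_tlift => p q.
by rewrite (tlift_tens Gb) hactM amulA.
Qed.

Fact smash_mul1l : left_id smash_one smash_mul.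
Proof.
apply: eq_linear_tens => [|//|a h]; first exact: linear_mull.
by rewrite smash_mulE comul1 (tlift_tens (Gin _ _ _)) hact1 !amul1l.
Qed.

Fact smash_mul1r : right_id smash_one smash_mul.
Proof.
apply: eq_linear_tens => [|//|a h]; first exact: linear_mulr.
rewrite smash_mulE -[in RHS](comul_counitl h).
rewrite (linear_tlift _ _ (fun c => (tens_bilin A H).2 a c)).
apply: eq_tlift => x y; rewrite hact_one (bilinZr amul_bilin) !(amul1l, amul1r).
by rewrite (bilinZl (tens_bilin _ _)) (bilinZr (tens_bilin _ _)).
Qed.

HB.instance Definition _ := isUAlg.Build K S
  smash_mulA smash_mul1l smash_mul1r smash_mul_bilin.

End Smash.

Section Seminorms.
Variable R : realType.

Definition is_seminorm (E : lmodType R[i]) (p : E -> R) : Prop :=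
  (forall x y, p (x + y) <= p x + p y) /\
  (forall c x, p (c *: x) = Normc.normc c * p x).

Definition submultiplicative (A : uAlgType R[i]) (p : A -> R) : Prop :=
  forall a b, p (a ** b) <= p a * p b.

Definition submult_seminorms (A : uAlgType R[i]) : set (A -> R) :=
  [set p | is_seminorm p /\ submultiplicative p].

Definition stable_seminorm (H : bialgType R[i]) (A : moduleAlgType H)
    (p : A -> R) : Prop :=
  forall h : H, exists2 C : R, 0 < C & forall x, p (hact h x) <= C * p x.

Definition stable_submult_seminorms (H : bialgType R[i])
    (A : moduleAlgType H) : set (A -> R) :=
  [set p | [/\ is_seminorm p, stable_seminorm p & submultiplicative p]].

(* The neighbourhoods of 0 in the topology defined by the seminorms of P. *)
Definition seminorm_nbhs0 (E : lmodType R[i]) (P : set (E -> R)) : set_system E :=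
  [set U | exists (n : nat) (p : 'I_n -> E -> R) (e : R),
    [/\ forall k, P (p k), 0 < e & [set x | forall k, p k x < e] `<=` U]].

End Seminorms.

(* A tvsType carries an arbitrary uniform structure compatible with its
   topology; completeness of a topological vector space refers to the
   translation-invariant one, hence this notion of Cauchy filter. *)
Definition linear_cauchy (K : numDomainType) (E : tvsType K)
    (F : set_system E) : Prop :=
  forall U, nbhs (0 : E) U ->
    exists2 A, F A & forall x y, A x -> A y -> U (x - y).

HB.mixin Record isCLCS (R : realType) E of Tvs R[i] E := {
  clcs_hausdorff : hausdorff_space E;
  clcs_complete : forall F : set_system E,
    ProperFilter F -> linear_cauchy F -> exists x : E, F --> x
}.

(* Complete Hausdorff locally convex spaces. *)
#[short(type="clcsType")]
HB.structure Definition CLCS (R : realType) := {E of isCLCS R E & Tvs R[i] E}.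

HB.mixin Record isHatAlg (R : realType) A of CLCS R A & UAlg R[i] A := {
  amul_continuous : continuous (fun z : A * A => z.1 ** z.2)
}.

#[short(type="hatAlgType")]
HB.structure Definition HatAlg (R : realType) :=
  {A of isHatAlg R A & CLCS R A & UAlg R[i] A}.

Section Completions.
Variable R : realType.

(* (X, i) is the Hausdorff completion of E for the topology defined by P. *)
Definition is_completion (E : lmodType R[i]) (P : set (E -> R))
    (X : clcsType R) (i : E -> X) : Prop :=
  [/\ linear i, dense (range i) &
      forall U : set E, (exists2 V, nbhs (0 : X) V & i @^-1` V `<=` U) <->
                        seminorm_nbhs0 P U].

Definition alg_morphism (A B : uAlgType R[i]) (f : A -> B) : Prop :=
  [/\ linear f, f \1 = \1 & {morph f : x y / x ** y}].

Definition is_AM_envelope (A : uAlgType R[i]) (X : hatAlgType R)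
    (i : A -> X) : Prop :=
  is_completion (@submult_seminorms R A) i /\ alg_morphism i.

Definition proj_seminorm (E F : lmodType R[i]) (p : E -> R) (q : F -> R)
    (u : tensor E F) : R :=
  inf [set r | exists2 s : seq (E * F), u = \sum_(x <- s) tens x.1 x.2
                                     & r = \sum_(x <- s) p x.1 * q x.2].

Definition proj_seminorms (E F : clcsType R) : set (tensor E F -> R) :=
  [set r | exists (p : E -> R) (q : F -> R),
    [/\ is_seminorm p, continuous p, is_seminorm q, continuous q
      & r = proj_seminorm p q]].

(* (T, t) is the completed projective tensor product of E and F. *)
Definition is_hat_tensor (E F T : clcsType R) (t : E -> F -> T) : Prop :=
  bilin t /\ is_completion (@proj_seminorms E F) (tlift t).

(* The continuous linear map on a completed tensor product (T, t) induced by
   a jointly continuous bilinear map f. *)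
Definition hat_lift (E F T X : clcsType R) (t : E -> F -> T)
    (f : E -> F -> X) : T -> X :=
  xget (fun=> 0) [set g : T -> X |
    [/\ linear g, continuous g & forall x y, g (t x y) = f x y]].

Definition hat_alg_iso (A B : hatAlgType R) (f : A -> B) : Prop :=
  [/\ alg_morphism f, continuous f &
      exists g : B -> A, [/\ cancel f g, cancel g f & continuous g]].

End Completions.

(* hsq is a model of the completed tensor square. Coassociativity is tested
   against all jointly continuous trilinear maps, i.e. against the universal
   one with values in the completed tensor cube. *)
HB.mixin Record isHatBialg (R : realType) B of HatAlg R B := {
  hsq : clcsType R;
  htens : B -> B -> hsq;
  hsqP : is_hat_tensor htens;
  hcomul : B -> hsq;
  hcounit : B -> R[i]^o;
  hcomul_linear : linear hcomul;
  hcomul_continuous : continuous hcomul;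
  hcounit_linear : linear hcounit;
  hcounit_continuous : continuous hcounit;
  hcomul_coassoc : forall (X : clcsType R) (w : B -> B -> B -> X),
    (forall y z, linear (fun x => w x y z)) ->
    (forall x z, linear (fun y => w x y z)) ->
    (forall x y, linear (w x y)) ->
    continuous (fun x : B * B * B => w x.1.1 x.1.2 x.2) ->
    forall b : B,
    hat_lift htens (fun x y => hat_lift htens (fun u v => w u v y) (hcomul x))
      (hcomul b) =
    hat_lift htens (fun x y => hat_lift htens (fun u v => w x u v) (hcomul y))
      (hcomul b);
  hcomul_counitl : forall b : B,
    hat_lift htens (fun x y : B => hcounit x *: y) (hcomul b) = b;
  hcomul_counitr : forall b : B,
    hat_lift htens (fun x y : B => hcounit y *: x) (hcomul b) = b;
  hcomul1 : hcomul \1 = htens \1 \1;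
  hcomulM : forall b c : B, hcomul (b ** c) =
    hat_lift htens (fun x y =>
      hat_lift htens (fun u v => htens (x ** u) (y ** v)) (hcomul c)) (hcomul b);
  hcounit1 : hcounit \1 = 1;
  hcounitM : forall b c : B, hcounit (b ** c) = hcounit b * hcounit c
}.

#[short(type="hatBialgType")]
HB.structure Definition HatBialg (R : realType) :=
  {B of isHatBialg R B & HatAlg R B}.

HB.mixin Record isHatModuleAlg (R : realType) (B : hatBialgType R) A
    of HatAlg R A := {
  hhact : B -> A -> A;
  hhact_bilin : bilin hhact;
  hhact_continuous : continuous (fun z : B * A => hhact z.1 z.2);
  hhact1 : forall a : A, hhact \1 a = a;
  hhactM : forall (b c : B) (a : A), hhact (b ** c) a = hhact b (hhact c a);
  hhact_mul : forall (b : B) (a a' : A), hhact b (a ** a') =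
    hat_lift htens (fun x y => hhact x a ** hhact y a') (hcomul b);
  hhact_one : forall b : B, hhact b \1 = (hcounit b : R[i]) *: (\1 : A)
}.

#[short(type="hatModuleAlgType")]
HB.structure Definition HatModuleAlg (R : realType) (B : hatBialgType R) :=
  {A of isHatModuleAlg R B A & HatAlg R A}.

Section SmashProducts.
Variable R : realType.

(* The Arens-Michael envelope of a bialgebra, as a completed bialgebra. *)
Definition is_bialg_envelope (H : bialgType R[i]) (B : hatBialgType R)
    (i : H -> B) : Prop :=
  [/\ is_AM_envelope i,
      forall h, hcomul (i h) = tlift (fun x y => htens (i x) (i y)) (comul h)
    & forall h, hcounit (i h) = counit h].

(* The H-completion of A, with the action of the envelope (B, iH) of H
   extending that of H. *)
Definition is_H_completion (H : bialgType R[i]) (A : moduleAlgType H)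
    (B : hatBialgType R) (iH : H -> B) (X : hatModuleAlgType B)
    (i : A -> X) : Prop :=
  [/\ is_completion (@stable_submult_seminorms R H A) i, alg_morphism i
    & forall h a, hhact (iH h) (i a) = i (hact h a)].

(* (S, t) is the analytic smash product of A and B. The product of S is jointly
   continuous, so it is determined by its values on elementary tensors. *)
Definition is_analytic_smash (B : hatBialgType R) (A : hatModuleAlgType B)
    (S : hatAlgType R) (t : A -> B -> S) : Prop :=
  [/\ is_hat_tensor t, \1 = t \1 \1 &
      forall a x b y, t a x ** t b y =
        hat_lift htens (fun u v => t (a ** hhact u b) (v ** y)) (hcomul x)].

Definition smash_map (H : bialgType R[i]) (A : moduleAlgType H)
    (B : hatBialgType R) (iH : H -> B) (X : hatModuleAlgType B) (iA : A -> X)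
    (S : hatAlgType R) (t : X -> B -> S) (u : smash A) : S :=
  tlift (fun a h => t (iA a) (iH h)) u.

End SmashProducts.

(* Main.v *)
Require Import Defs.
From mathcomp Require Import all_boot all_order all_algebra.
From mathcomp Require Import complex ring lra.
From mathcomp Require Import all_classical all_reals all_analysis.

(* Write j for the canonical map from A # H to S. Extending j, and the
   restrictions of iE to A and H, by continuity gives maps f : E -> S and
   alpha (x) beta : S -> E, which are mutually inverse by density. Both
   extensions exist because the topologies match:
   - If p is a stable submultiplicative seminorm on A and q a submultiplicative
     one on H, left multiplication by any u in A # H is bounded for the
     projective seminorm N of p and q. The operator seminorm r of the left
     regular representation is submultiplicative and N <= N(1) r; this makes j
     continuous.
   - If r is a submultiplicative seminorm on A # H, its restriction to A is
     stable, because h . a = \sum h_1 a S(h_2) in A # H; this makes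
     alpha continuous.
   Every continuity argument about completed tensor products uses the gauges of
   the convex neighbourhoods of 0. *)

Set Implicit Arguments.
Unset Strict Implicit.
Unset Printing Implicit Defensive.

Import Order.TTheory GRing.Theory Num.Theory.
Import numFieldNormedType.Exports.

Local Open Scope classical_set_scope.
Local Open Scope ring_scope.
Local Open Scope complex_scope.

Lemma linear_compose (K : pzRingType) (X Y Z : lmodType K) (f : X -> Y)
    (g : Y -> Z) : linear f -> linear g -> linear (fun x => g (f x)).
Proof. by move=> fl gl c x y; rewrite fl gl. Qed.

(** * Seminorms *)

Section Normc.
Variable R : realType.
Implicit Type c : R[i].

Lemma normc_ge0 c : 0 <= Normc.normc c.
Proof. by case: c => a b; exact: sqrtr_ge0. Qed.

Lemma normc_gt0 c : c != 0 -> 0 < Normc.normc c.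
Proof.
move=> c0; rewrite lt_neqAle normc_ge0 andbT eq_sym.
by apply: contra c0 => /eqP/Normc.eq0_normc ->.
Qed.

Lemma normc_real (s : R) : Normc.normc s%:C = `|s|.
Proof. by rewrite /= expr0n /= addr0 sqrtr_sqr. Qed.

Lemma normc_normE c : `|c| = (Normc.normc c)%:C.
Proof. by rewrite normc_def; case: c. Qed.

Lemma realC_neq0 (e : R) : 0 < e -> e%:C != 0 :> R[i].
Proof. by move=> e0; rewrite eq_complex /= eqxx andbT gt_eqF. Qed.

End Normc.

Section Seminorm.
Variables (R : realType) (E : lmodType R[i]).
Implicit Types (p q : E -> R) (x y : E).

(** The reverse inequality for [c != 0] is the given one for [c^-1] at [c *: x]; for [c = 0] it
    reads [0 <= p 0], which follows from subadditivity at [0]. *)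
Lemma le_seminorm p : (forall x y, p (x + y) <= p x + p y) ->
  (forall c x, p (c *: x) <= Normc.normc c * p x) -> is_seminorm p.
Proof.
move=> pD pZ; split=> // c x; apply/eqP; rewrite eq_le pZ /=.
have [->|c0] := eqVneq c 0.
  by rewrite Normc.normc0 mul0r scale0r; have := pD 0 0; rewrite addr0; lra.
have nc0 := normc_gt0 c0.
rewrite -ler_pdivlMl // -Normc.normcV.
by rewrite -[x in leLHS]scale1r -(mulVf c0) -scalerA; exact: pZ.
Qed.

Section Theory.
Variable p : E -> R.
Hypothesis sp : is_seminorm p.

Lemma seminorm0 : p 0 = 0.
Proof. by rewrite -(scale0r 0) sp.2 Normc.normc0 mul0r. Qed.

Lemma seminormN x : p (- x) = p x.
Proof. by rewrite -scaleN1r sp.2 normcN Normc.normc1 mul1r. Qed.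

Lemma seminorm_ge0 x : 0 <= p x.
Proof. by have := sp.1 x (- x); rewrite subrr seminorm0 seminormN; lra. Qed.

Lemma seminormZ (s : R) x : 0 <= s -> p (s%:C *: x) = s * p x.
Proof. by move=> s0; rewrite sp.2 normc_real ger0_norm. Qed.

Lemma seminorm_dist x y : `|p x - p y| <= p (x - y).
Proof.
have := sp.1 (x - y) y; have := sp.1 (y - x) x.
by rewrite !subrK -(opprB x y) seminormN ler_norml; lra.
Qed.

Lemma seminorm_sum (I : Type) (s : seq I) (F : I -> E) :
  p (\sum_(i <- s) F i) <= \sum_(i <- s) p (F i).
Proof.
elim: s => [|i s ih]; first by rewrite !big_nil seminorm0.
by rewrite !big_cons (le_trans (sp.1 _ _))// lerD2l.
Qed.

End Theory.

Lemma seminorm_le_ball p q (e C : R) : is_seminorm p -> is_seminorm q ->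
  0 < e -> (forall x, q x < e -> p x <= C) -> forall x, p x <= C / e * q x.
Proof.
move=> sp sq e0 qp x.
have C0 : 0 <= C by have := qp 0; rewrite !seminorm0// => /(_ e0).
have qx0 := seminorm_ge0 sq x.
(* As [q x] may vanish, [x] is rescaled into the ball by [e / (q x + d)], and [d] then tends to
   0. *)
have bd d : 0 < d -> p x <= C / e * (q x + d).
  move=> d0; have s0 : 0 < q x + d by rewrite ltr_wpDl.
  have := qp ((e / (q x + d))%:C *: x).
  rewrite !seminormZ ?divr_ge0 ?(ltW e0) ?(ltW s0)//.
  rewrite mulrAC ltr_pdivrMr// ltr_pM2l// ltrDl => /(_ d0).
  by rewrite mulrAC ler_pdivrMr// [C / e * _]mulrAC ler_pdivlMr//
    [p x * e]mulrC.
apply/ler_addgt0Pr => d d0; have Ce0 : 0 <= C / e by rewrite divr_ge0// ltW.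
have Ce1 : 0 < C / e + 1 by rewrite ltr_wpDl.
apply: le_trans (bd (d / (C / e + 1)) _) _; first by rewrite divr_gt0.
rewrite mulrDr lerD2l mulrA ler_pdivrMr// mulrC ler_wpM2l ?ltW//.
by rewrite ltrDl.
Qed.

Lemma seminorm_const0 : is_seminorm (fun _ : E => 0 : R).
Proof. by split=> *; rewrite ?addr0 ?mulr0. Qed.

Lemma seminormD p q : is_seminorm p -> is_seminorm q ->
  is_seminorm (fun x => p x + q x).
Proof.
move=> [pD pZ] [qD qZ]; split=> [x y|c x]; last by rewrite pZ qZ mulrDr.
by have := pD x y; have := qD x y; lra.
Qed.

Lemma seminorm_comp (F : lmodType R[i]) (f : F -> E) p :
  linear f -> is_seminorm p -> is_seminorm (p \o f).
Proof.
move=> fl sp; have fD (x y : F) : f (x + y) = f x + f y.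
  by rewrite -[x in LHS]scale1r fl scale1r.
have f0 : f 0 = 0 by apply: (addIr (f 0)); rewrite -fD !addr0 add0r.
split=> [x y|c x] /=; first by rewrite fD; exact: sp.1.
by rewrite -[c *: x]addr0 fl f0 addr0 sp.2.
Qed.

(** The sum of a finite family dominates each member, so it can replace the family; the zero
    seminorm accounts for the empty family. *)
Lemma seminorm_nbhs0_single (P : set (E -> R)) (U : set E) :
  P (fun=> 0) -> (forall p q, P p -> P q -> P (fun x => p x + q x)) ->
  P `<=` @is_seminorm R E -> seminorm_nbhs0 P U ->
  exists2 p, P p & exists2 e : R, 0 < e & [set x | p x < e] `<=` U.
Proof.
move=> P0 PD Ps [n [p [e [Pp e0 pU]]]].
exists (fun x => \sum_(k < n) p k x); last first.
  exists e => // x /= px; apply: pU => k /=; apply: le_lt_trans px.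
  by rewrite (bigD1 k) //= lerDl sumr_ge0// => l _; exact/seminorm_ge0/Ps.
elim: n p Pp {pU} => [|n ih] p Pp.
  by under eq_fun do rewrite big_ord0.
under eq_fun do rewrite big_ord_recl.
by apply: (PD _ (fun x => \sum_(i < n) p (lift ord0 i) x)) => //; exact: ih.
Qed.

End Seminorm.

(** Continuity criterion at 0 between spaces topologized by families of seminorms. *)
Lemma seminorm_nbhs0_comp (R : realType) (E F : lmodType R[i])
    (P : set (E -> R)) (Q : set (F -> R)) (f : F -> E) (U : set E) :
  (forall p, P p ->
    exists2 q, Q q & exists C : R, forall x, p (f x) <= C * q x) ->
  Q `<=` @is_seminorm R F ->
  seminorm_nbhs0 P U -> seminorm_nbhs0 Q (f @^-1` U).
Proof.
move=> PQ Qs [n [p [e [Pp e0 pU]]]].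
have /choice [q qP] : forall k, exists q, Q q /\ exists2 C : R, 0 < C &
    forall x, p k (f x) <= C * q x.
  move=> k; have [q Qq [C pC]] := PQ _ (Pp k); exists q; split=> //.
  exists (Num.max C 1); first by rewrite lt_max ltr01 orbT.
  move=> x; rewrite (le_trans (pC x))// ler_wpM2r ?le_max ?lexx//.
  exact: (seminorm_ge0 (Qs _ Qq)).
have /choice [C CP] : forall k, exists C : R, 0 < C /\
    forall x, p k (f x) <= C * q k x.
  by move=> k; have [_ [C C0 pC]] := qP k; exists C.
have S0 : 0 < 1 + \sum_k C k.
  by rewrite ltr_pwDl// sumr_ge0// => k _; exact/ltW/(CP k).1.
exists n, q, (e / (1 + \sum_k C k)); split; first by move=> k; exact: (qP k).1.
  by rewrite divr_gt0.
move=> x /= qx; apply: pU => k /=; have [Ck0 pC] := CP k.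
rewrite (le_lt_trans (pC x))// -ltr_pdivlMl// mulrC (lt_le_trans (qx k))//.
rewrite ler_pM2l// lef_pV2 ?posrE// (bigD1 k) //= addrCA lerDl.
by rewrite addr_ge0// sumr_ge0// => l _; exact/ltW/(CP l).1.
Qed.

(** * Projective seminorms on algebraic tensor products *)

Section ProjSeminorm.
Variables (R : realType) (E F : lmodType R[i]) (p : E -> R) (q : F -> R).
Hypotheses (sp : is_seminorm p) (sq : is_seminorm q).
Local Notation pq := (proj_seminorm p q).

Let cost (s : seq (E * F)) := \sum_(x <- s) p x.1 * q x.2.

Let cost_ge0 s : 0 <= cost s.
Proof. by apply: sumr_ge0 => x _; rewrite mulr_ge0 ?seminorm_ge0. Qed.

Lemma proj_seminorm_le (s : seq (E * F)) :
  pq (\sum_(x <- s) tens x.1 x.2) <= \sum_(x <- s) p x.1 * q x.2.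
Proof.
by apply: ge_inf; [exists 0 => _ [s' _ ->]; exact: cost_ge0|exists s].
Qed.

Lemma proj_seminorm_tens x y : pq (tens x y) <= p x * q y.
Proof. by have := proj_seminorm_le [:: (x, y)]; rewrite !big_seq1. Qed.

Lemma le_proj_seminorm_inf (m : R) (u : tensor E F) :
  (forall s : seq (E * F), u = \sum_(x <- s) tens x.1 x.2 ->
    m <= \sum_(x <- s) p x.1 * q x.2) -> m <= pq u.
Proof.
move=> mle; apply: lb_le_inf; last by move=> _ [s us ->]; exact: mle.
by exists (cost (repr u)), (repr u) => //; exact: tensorE.
Qed.

Lemma proj_seminorm_seminorm : is_seminorm pq.
Proof.
apply: le_seminorm => [u v|c u].
  (* The two infima on the right are removed in turn; concatenating representations of [u] and [v]
     represents [u + v]. *)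
  rewrite -lerBlDr; apply: le_proj_seminorm_inf => s ->.
  rewrite lerBlDr -lerBlDl; apply: le_proj_seminorm_inf => s' ->.
  by rewrite lerBlDl -!big_cat /= proj_seminorm_le.
have [->|c0] := eqVneq c 0.
  rewrite scale0r Normc.normc0 mul0r.
  by have := proj_seminorm_le [::]; rewrite !big_nil.
have nc0 := normc_gt0 c0.
rewrite -ler_pdivrMl//; apply: le_proj_seminorm_inf => s ->.
rewrite ler_pdivrMl// scaler_sumr mulr_sumr.
have := proj_seminorm_le (tscale c s); rewrite !big_map /=.
under eq_bigr do rewrite (bilinZl (tens_bilin E F)).
by under [X in _ <= X]eq_bigr do rewrite sp.2 -mulrA.
Qed.

(** Apply [r] to a representation of [u], bound it termwise and take the infimum over
    representations. *)
Lemma le_proj_seminorm (X : lmodType R[i]) (r : X -> R) (f : E -> F -> X)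
    (C : R) (u : tensor E F) :
  is_seminorm r -> bilin f -> 0 < C ->
  (forall x y, r (f x y) <= C * (p x * q y)) -> r (tlift f u) <= C * pq u.
Proof.
move=> sr fb C0 rf; rewrite -ler_pdivrMl//; apply: le_proj_seminorm_inf => s us.
rewrite ler_pdivrMl// us -pi_tensor_sum tlift_pi// mulr_sumr.
by apply: le_trans (seminorm_sum sr _ _) _; exact: ler_sum.
Qed.

End ProjSeminorm.

(* The witness is the operator seminorm of the left regular representation on
   (A, N). *)
Lemma submult_seminorm_dominating (R : realType) (A : uAlgType R[i])
    (N : A -> R) : is_seminorm N ->
  (forall a, exists C, forall b, N (a ** b) <= C * N b) ->
  exists2 r, submult_seminorms r & forall a, N a <= N \1 * r a.
Proof.
move=> sN bd.
pose D a := [set C : R | 0 <= C /\ forall b, N (a ** b) <= C * N b].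
pose r a := inf (D a).
have lb a : has_lbound (D a) by exists 0 => C [].
have r0 a : 0 <= r a.
  apply: lb_le_inf => [|C []//]; have [C aC] := bd a.
  exists (Num.max C 0); split=> [|b]; first by rewrite le_max lexx orbT.
  by rewrite (le_trans (aC b))// ler_wpM2r ?seminorm_ge0// le_max lexx.
have rM a b : N (a ** b) <= r a * N b.
  have [C aC] := bd a.
  (* The infimum [r a] is itself admissible. When [N b = 0] one cannot divide, but any admissible
     constant already gives [N (a ** b) <= 0]. *)
  have [b0|b0] := eqVneq (N b) 0; first by have := aC b; rewrite b0 !mulr0.
  have Nb : 0 < N b by rewrite lt_neqAle eq_sym b0 seminorm_ge0.
  rewrite -ler_pdivrMr//; apply: lb_le_inf; last first.
    by move=> {aC}C [_ aC]; rewrite ler_pdivrMr.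
  exists (Num.max C 0); split=> [|c]; first by rewrite le_max lexx orbT.
  by rewrite (le_trans (aC c))// ler_wpM2r ?seminorm_ge0// le_max lexx.
exists r; last by move=> a; rewrite mulrC -[a in N a]amul1r.
split; last first.
  move=> a b; apply: ge_inf => //; split=> [|c]; first by rewrite mulr_ge0.
  by rewrite -amulA (le_trans (rM _ _))// -mulrA ler_wpM2l.
apply: le_seminorm => [a b|c a]; apply: ge_inf => //; split=> [|d].
- by rewrite addr_ge0.
- by rewrite (bilinDl (@amul_bilin _ _)) (le_trans (sN.1 _ _))// mulrDl lerD.
- by rewrite mulr_ge0// normc_ge0.
- by rewrite (bilinZl (@amul_bilin _ _)) sN.2 -mulrA ler_wpM2l// normc_ge0.
Qed.

Section SubmultSeminorms.
Variable R : realType.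

Lemma submult_seminorms0 (A : uAlgType R[i]) :
  @submult_seminorms R A (fun=> 0).
Proof. by split=> [|a b]; [exact: seminorm_const0|rewrite mulr0]. Qed.

Lemma submult_seminormsD (A : uAlgType R[i]) (p q : A -> R) :
  submult_seminorms p -> submult_seminorms q ->
  submult_seminorms (fun a => p a + q a).
Proof.
move=> [sp pM] [sq qM]; split=> [|a b]; first exact: seminormD.
have := pM a b; have := qM a b.
have := seminorm_ge0 sp a; have := seminorm_ge0 sp b.
have := seminorm_ge0 sq a; have := seminorm_ge0 sq b; nra.
Qed.

Variables (H : bialgType R[i]) (A : moduleAlgType H).

Lemma stable_submult_seminorms0 : @stable_submult_seminorms R H A (fun=> 0).
Proof.
have [s sM] := submult_seminorms0 A; split=> // h.
by exists 1 => // x; rewrite mulr0.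
Qed.

Lemma stable_submult_seminormsD (p q : A -> R) :
  stable_submult_seminorms p -> stable_submult_seminorms q ->
  stable_submult_seminorms (fun a => p a + q a).
Proof.
move=> [sp pH pM] [sq qH qM].
have [s sM] := submult_seminormsD (conj sp pM) (conj sq qM); split=> // h.
have [C C0 pC] := pH h; have [D D0 qD] := qH h.
exists (C + D) => [|a]; first exact: addr_gt0.
have := seminorm_ge0 sp a; have := seminorm_ge0 sq a.
by have := pC a; have := qD a; nra.
Qed.

End SubmultSeminorms.

(** * The algebraic smash product *)

Section SmashTheory.
Variables (R : realType) (H : bialgType R[i]) (A : moduleAlgType H).

Lemma smash_mul_bilinear a b k :
  bilin (fun x y => tens (a ** hact x b) (y ** k) : smash A).
Proof.
split=> [y|x] c u v.
  by rewrite (hact_bilin.1 b) amul_linr; exact: (tens_bilin A H).1.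
by rewrite amul_linl; exact: (tens_bilin A H).2.
Qed.

Definition smash_inl (a : A) : smash A := tens a \1.
Definition smash_inr (h : H) : smash A := tens \1 h.

Lemma smash_inl_inr a h : smash_inl a ** smash_inr h = tens a h.
Proof.
rewrite -[LHS]/(smash_mul _ _) smash_mulE comul1.
by rewrite (tlift_tens (smash_mul_bilinear _ _ _)) hact1 amul1r amul1l.
Qed.

Lemma smash_inr_inl a h : smash_inr h ** smash_inl a =
  tlift (fun x y => smash_inl (hact x a) ** smash_inr y) (comul h).
Proof.
rewrite -[LHS]/(smash_mul _ _) smash_mulE; apply: eq_tlift => x y.
by rewrite smash_inl_inr amul1l amul1r.
Qed.

Lemma smash_inl_morphism : alg_morphism smash_inl.
Proof.
split=> // [|a b]; first exact: (tens_bilin A H).1.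
rewrite -[RHS]/(smash_mul _ _) smash_mulE comul1.
by rewrite (tlift_tens (smash_mul_bilinear _ _ _)) hact1 amul1r.
Qed.

(** Elements of [H] act on [\1] through the counit, so the twisted product of [tens \1 h] and
    [tens \1 k] collapses by the left counit axiom. *)
Lemma smash_inr_morphism : alg_morphism smash_inr.
Proof.
split=> // [|h k]; first exact: (tens_bilin A H).2.
rewrite -[RHS]/(smash_mul _ _) smash_mulE -[h in LHS]comul_counitl.
have l : linear (fun x : H => smash_inr (x ** k)).
  by move=> c x y; rewrite amul_linl; exact: (tens_bilin A H).2.
rewrite (linear_tlift _ _ l); apply: eq_tlift => x y.
rewrite hact_one amul1l /smash_inr (bilinZl (@amul_bilin _ _)).
by rewrite (bilinZl (tens_bilin _ _)) (bilinZr (tens_bilin _ _)).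
Qed.

End SmashTheory.

(* The action becomes inner in the smash product: h acts as
   a |-> \sum h_1 a S(h_2). *)
Lemma smash_hact (R : realType) (H : hopfType R[i]) (A : moduleAlgType H)
    (h : H) (a : A) :
  smash_inl (hact h a) =
  tlift (fun x y => smash_inr A x ** smash_inl a ** smash_inr A (antipode y))
    (comul h).
Proof.
(* Both bracketings of the iterated coproduct of [h] are evaluated on [w]. The right one gives
   [hact h a] by the antipode and counit axioms, the left one gives the conjugation formula. *)
pose w x u v : smash A := tens (hact x a) (u ** antipode v).
have wb x : bilin (w x).
  split=> [v|u] c y z; rewrite /w.
    by rewrite amul_linl; exact: (tens_bilin A H).2.
  by rewrite antipode_linear amul_linr; exact: (tens_bilin A H).2.
have wt : bilin (fun x u => tlift (w x) u).
  split=> [u|x]; last exact: (tlift_linear (wb x)).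
  move=> c x y; rewrite -tliftP; apply: eq_tlift => b d.
  by rewrite /w (hact_bilin.1 a); exact: (tens_bilin A H).1.
have /(congr1 (tlift (fun x u => tlift (w x) u))) := comul_coassoc h.
rewrite !(linear_tlift _ _ (tlift_linear wt)) => e.
transitivity (tlift (fun x y => tlift (w x) (comul y)) (comul h)).
  rewrite -[h in LHS]comul_counitr.
  have l : linear (fun x => smash_inl (hact x a)).
    by move=> c x y; rewrite (hact_bilin.1 a); exact: (tens_bilin A H).1.
  rewrite (linear_tlift _ _ l); apply: eq_tlift => x y.
  rewrite -(linear_tlift _ _ ((tens_bilin A H).2 (hact x a))) antipoder.
  rewrite (bilinZl hact_bilin) /smash_inl (bilinZl (tens_bilin _ _)).
  by rewrite (bilinZr (tens_bilin _ _)).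
transitivity (tlift (fun x y => tlift (fun u => tlift (w u))
    (tens x (comul y))) (comul h)).
  by apply: eq_tlift => x y; rewrite (tlift_tens wt).
(* Left bracketing: the coproduct of [x] regroups into the product of [smash_inr A x] and
   [smash_inl a]. *)
rewrite -e; apply: eq_tlift => x y.
rewrite (linear_tlift _ _ (tlift_linear wt)) smash_inr_inl.
rewrite (linear_tlift _ _
  ((@amul_bilin _ (smash A)).1 (smash_inr A (antipode y)))).
apply: eq_tlift => u v; rewrite (tlift_tens wt) (tlift_tens (wb _)).
by have [_ _ inrM] := smash_inr_morphism A; rewrite -amulA -inrM smash_inl_inr.
Qed.

(** * Comparison of seminorms on the smash product and on its factors *)

Section SmashSeminorms.
Variable R : realType.

Lemma submult_seminorms_comp (A B : uAlgType R[i]) (f : A -> B) (p : B -> R) :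
  alg_morphism f -> submult_seminorms p -> submult_seminorms (p \o f).
Proof.
move=> [fl _ fM] [sp pM]; split=> [|a b /=]; first exact: seminorm_comp.
by rewrite fM.
Qed.

Lemma smash_inl_stable (H : hopfType R[i]) (A : moduleAlgType H)
    (r : smash A -> R) :
  submult_seminorms r -> stable_submult_seminorms (r \o @smash_inl _ H A).
Proof.
move=> rS; have [sr rM] := rS.
have [s sM] := submult_seminorms_comp (smash_inl_morphism A) rS; split=> // h.
pose c (x : H * H) := r (smash_inr A x.1) * r (smash_inr A (antipode x.2)).
have c0 x : 0 <= c x by rewrite mulr_ge0 ?seminorm_ge0.
(* Submultiplicativity applied to each summand of [smash_hact] gives the sum; the 1 makes the
   constant strictly positive, as stability demands. *)
exists (1 + \sum_(x <- repr (comul h)) c x) => [|a /=].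
  by rewrite ltr_pwDl// sumr_ge0.
rewrite smash_hact (le_trans (seminorm_sum sr _ _))// mulrDl mul1r.
rewrite ler_wpDl ?(seminorm_ge0 sr)// mulr_suml ler_sum// => x _.
rewrite (le_trans (rM _ _))// /c mulrAC ler_wpM2r ?(seminorm_ge0 sr)//.
Qed.

Variables (H : bialgType R[i]) (A : moduleAlgType H).

(** Multiplying [tens b k] on the left by [tens a h] gives the sum of [a (h_1 . b)] tensor [h_2 k].
    Submultiplicativity of [p] and [q] and stability of [p] bound each term by a multiple of
    [p b * q k]. *)
Lemma proj_seminorm_mul_bounded (p : A -> R) (q : H -> R) (u : smash A) :
  stable_submult_seminorms p -> submult_seminorms q ->
  exists C : R, forall v,
    proj_seminorm p q (u ** v) <= C * proj_seminorm p q v.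
Proof.
move=> [sp pH pM] [sq qM]; have sN := proj_seminorm_seminorm sp sq.
have N0 := seminorm_ge0 sN.
(* A general [u] is a finite sum of elementary tensors, and the constants add up. *)
suff bd a h : exists2 C : R, 0 <= C & forall v,
    proj_seminorm p q ((tens a h : smash A) ** v) <= C * proj_seminorm p q v.
  rewrite (tensorE u) /tlift; elim: (repr u) => [|[a h] s [C uC]].
    exists 0 => v; rewrite big_nil mul0r (bilin0l (@amul_bilin _ _)).
    by rewrite (seminorm0 sN).
  have [D D0 aD] := bd a h; exists (D + C) => v.
  rewrite big_cons (bilinDl (@amul_bilin _ _)) (le_trans (sN.1 _ _))//.
  by rewrite mulrDl lerD.
have /choice[K KP] : forall x, exists K : R,
    0 <= K /\ forall b, p (hact x b) <= K * p b.
  by move=> x; have [K K0 pK] := pH x; exists K; rewrite ltW.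
pose C := \sum_(x <- repr (comul h)) p a * K x.1 * q x.2.
have C0 : 0 <= C.
  apply: sumr_ge0 => x _.
  by rewrite !mulr_ge0 ?(seminorm_ge0 sp) ?(seminorm_ge0 sq)//; exact: (KP _).1.
exists (1 + C) => [|v]; first by rewrite addr_ge0.
have fb : bilin (fun b k => (tens a h : smash A) ** (tens b k : smash A)).
  split=> [k|b] c x y.
    by rewrite ((tens_bilin A H).1 k); exact: (@amul_bilin _ (smash A)).2.
  by rewrite ((tens_bilin A H).2 b); exact: (@amul_bilin _ (smash A)).2.
rewrite [v in leLHS]tensorE.
rewrite (linear_tlift _ _ ((@amul_bilin _ (smash A)).2 (tens a h))).
apply: le_proj_seminorm => // [|b k]; first by rewrite ltr_pwDl.
rewrite -[X in proj_seminorm p q X]/(smash_mul _ _) smash_mulE.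
rewrite (le_trans (seminorm_sum sN _ _))// mulrDl mul1r ler_wpDl//.
  by rewrite mulr_ge0 ?seminorm_ge0.
rewrite mulr_suml ler_sum// => -[x y] _ /=.
rewrite (le_trans (proj_seminorm_tens sp sq _ _))//.
have [K0 pK] := KP x.
rewrite (_ : _ * (_ * _) = (p a * (K x * p b)) * (q y * q k)); last by ring.
rewrite ler_pM ?seminorm_ge0//.
by rewrite (le_trans (pM _ _))// ler_wpM2l ?seminorm_ge0.
Qed.

Lemma proj_seminorm_le_submult (p : A -> R) (q : H -> R) :
  stable_submult_seminorms p -> submult_seminorms q ->
  exists2 r : smash A -> R, submult_seminorms r &
    exists C : R, forall u, proj_seminorm p q u <= C * r u.
Proof.
move=> pS qS; have [sp _ _] := pS; have [sq _] := qS.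
have [r rS rN] := @submult_seminorm_dominating R (smash A) (proj_seminorm p q)
  (proj_seminorm_seminorm sp sq)
  (fun u => proj_seminorm_mul_bounded u pS qS).
by exists r => //; exists (proj_seminorm p q (\1 : smash A)).
Qed.

End SmashSeminorms.

(** * Locally convex spaces *)

Section TvsTheory.
Variable R : realType.
Implicit Types X Y : tvsType R[i].

Lemma linear_combination_continuous X (c : R[i]) :
  continuous (fun z : X * X => c *: z.1 + z.2).
Proof.
move=> z; apply: (@continuous2_cvg _ X X X _ _ (fun z => c *: z.1) snd +%R).
- exact: (@add_continuous X (_, _)).
- apply: (@continuous2_cvg _ R[i]^o X X _ _ (fun=> c) fst *:%R).
  + exact: (@scale_continuous _ X (_, _)).
  + exact: cvg_cst.
  + exact: cvg_fst.
- exact: cvg_snd.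
Qed.

Lemma nbhs0_translate X (x : X) (V : set X) :
  nbhs x V -> nbhs 0 [set v | V (x + v)].
Proof.
move=> /(nbhsB (- x)); rewrite addNr; apply: filterS => _ [v Vv <-] /=.
by rewrite addrA subrr add0r.
Qed.

Lemma continuous_linear0 X Y (f : X -> Y) : linear f ->
  (forall V, nbhs 0 V -> nbhs 0 (f @^-1` V)) -> continuous f.
Proof.
move=> fl f0 x V /nbhs0_translate/f0/(nbhsT x).
apply: filterS => _ [u fu <-] /=.
by move: fu => /=; rewrite addrC -[f u in X in X -> _]scale1r -fl scale1r addrC.
Qed.

Lemma continuous_seminorm X (p : X -> R) : is_seminorm p ->
  nbhs 0 [set x | p x < 1] -> continuous p.
Proof.
move=> sp p1 x; apply/cvgrPdist_lt => e e0.
have := nbhsT x (nbhs0Z (realC_neq0 e0) p1).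
apply: filterS => _ [_ [u /= pu <-] <-].
rewrite (le_lt_trans (seminorm_dist sp _ _))// opprD addrA subrr add0r.
by rewrite (seminormN sp) (seminormZ sp) ?ltW// gtr_pMr.
Qed.

Lemma seminorm_nbhs X (p : X -> R) (e : R) : is_seminorm p -> continuous p ->
  0 < e -> nbhs 0 [set x | p x < e].
Proof.
move=> sp pc e0; have /cvgrPdist_lt/(_ e e0) := pc 0.
apply: filterS => x /=; rewrite (seminorm0 sp) sub0r normrN ger0_norm//.
exact: seminorm_ge0.
Qed.

(** Joint continuity of scaling at [(0, 0)] puts the product of a disc of radius [d] and some [U]
    inside [V]. Then [(d / 2) U] works: [c * (d / 2)] stays in the open disc whenever [c] has
    modulus at most 1. *)
Lemma nbhs0_balanced X (V : set X) : nbhs 0 V ->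
  nbhs 0 [set x | forall c : R[i], Normc.normc c <= 1 -> V (c *: x)].
Proof.
move=> V0; have := @scale_continuous _ X (0, 0) V; rewrite /= scaler0.
move=> /(_ V0)[[B U] /= [/nbhs_ballP[/= d d0 dB] U0 BU]].
have d20 : 0 < d / 2 by rewrite divr_gt0.
apply: filterS (nbhs0Z (lt0r_neq0 d20) U0) => _ [u Uu <-] c c1 /=.
rewrite scalerA; apply: (BU (c * (d / 2), u)); split=> //=; apply: dB.
rewrite -ball_normE /= sub0r normrN normrM (gtr0_norm d20).
rewrite (@le_lt_trans _ _ (d / 2))//.
  by rewrite ler_piMl ?(ltW d20)// normc_normE lecR.
by rewrite ltr_pdivrMr// mulr_natr mulr2n ltrDl.
Qed.

Lemma nbhs0_absorbing X (V : set X) (x : X) : nbhs 0 V ->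
  exists2 s : R, 0 < s & V (s^-1%:C *: x).
Proof.
move=> V0; have := @scale_continuous _ X (0, x) V; rewrite /= scale0r.
move=> /(_ V0)[[B U] /= [/nbhs_ballP[/= d d0 dB] Ux BU]].
have d20 : 0 < d / 2 by rewrite divr_gt0.
(* The radius lives in [R[i]]; being positive it is real, so its real part provides the scaling
   factor in [R]. *)
have dE : d / 2 = (complex.Re (d / 2))%:C.
  by move: d20; case: (d / 2) => a b; rewrite ltcE /= => /andP[/eqP-> _].
have rd0 : 0 < complex.Re (d / 2) by rewrite -ltcR -dE.
exists (complex.Re (d / 2))^-1; first by rewrite invr_gt0.
rewrite invrK -dE; apply: (BU (d / 2, x)); split; last exact: nbhs_singleton.
apply: dB; rewrite -ball_normE /= sub0r normrN (gtr0_norm d20).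
by rewrite ltr_pdivrMr// mulr_natr mulr2n ltrDl.
Qed.

End TvsTheory.

(** * Gauges of neighbourhoods of 0 *)

Section Gauge.
Variables (R : realType) (X : tvsType R[i]).

Lemma nbhs0_convex (V : set X) : nbhs 0 V ->
  exists U, [/\ nbhs 0 U, U `<=` V & forall x y (t : R), U x -> U y ->
    0 <= t <= 1 -> U (t%:C *: x + (1 - t)%:C *: y)].
Proof.
move=> V0; have [B Bc [Bo Bcvg]] := @locally_convex _ X.
have [U [BU U0] UV] := Bcvg 0 V V0.
exists U; split=> //; first by apply: open_nbhs_nbhs; split=> //; exact: Bo.
move=> x y t Ux Uy /andP[t0 t1].
have t0' : 0 <= t%:C :> R[i] by rewrite lecR.
have t1' : t%:C <= 1 :> R[i] by rewrite lecR.
rewrite rmorphB rmorph1; apply/set_mem.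
exact: (Bc _ (mem_set BU) x y (Itv01 t0' t1') (mem_set Ux) (mem_set Uy)).
Qed.

(** [p] is the Minkowski gauge of the balanced core [W] of a convex neighbourhood [U] inside [V].
    Convexity of [U] yields subadditivity, balancedness of [W] yields homogeneity. *)
Lemma nbhs0_seminorm (V : set X) : nbhs 0 V ->
  exists p : X -> R,
    [/\ is_seminorm p, continuous p & [set x | p x < 1] `<=` V].
Proof.
move=> /nbhs0_convex[U [U0 UV Uc]].
pose W := [set x | forall c : R[i], Normc.normc c <= 1 -> U (c *: x)].
have W0 : nbhs 0 W by exact: nbhs0_balanced.
have WZ c x : Normc.normc c <= 1 -> W x -> W (c *: x).
  move=> c1 Wx d d1; rewrite scalerA; apply: Wx.
  by rewrite Normc.normcM mulr_ile1// normc_ge0.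
pose D x := [set s : R | 0 < s /\ W (s^-1%:C *: x)].
pose p x := inf (D x).
have Dlb x : has_lbound (D x) by exists 0 => s [/ltW].
have D0 x : D x !=set0 by have [s s0 Ws] := nbhs0_absorbing x W0; exists s.
have sp : is_seminorm p.
  apply: le_seminorm => [x y|c x].
    rewrite -lerBlDr; apply: lb_le_inf => // s [s0 Ws].
    rewrite lerBlDr -lerBlDl; apply: lb_le_inf => // r [r0 Wr].
    rewrite lerBlDl; apply: ge_inf => //.
    split=> [|c c1]; first exact: addr_gt0.
    have sr0 : 0 < s + r by exact: addr_gt0.
    (* With weights [s / (s + r)] and [r / (s + r)], the convex combination of [x / s] and [y / r]
       is [(x + y) / (s + r)]. *)
    have := Uc _ _ (s / (s + r)) (Ws c c1) (Wr c c1).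
    rewrite divr_ge0 ?(ltW s0) ?(ltW sr0)//.
    rewrite ler_pdivrMr// mul1r lerDl (ltW r0) => /(_ isT).
    rewrite !scalerDr !scalerA ![_ * c * _]mulrAC ![_ * c]mulrC -!rmorphM /=.
    rewrite (_ : s / (s + r) * s^-1 = (s + r)^-1); last first.
      by field; rewrite !gt_eqF.
    rewrite (_ : (1 - s / (s + r)) * r^-1 = (s + r)^-1)//.
    by field; rewrite !gt_eqF.
  have [->|c0] := eqVneq c 0.
    rewrite Normc.normc0 mul0r scale0r; apply/ler_addgt0Pr => e e0.
    rewrite add0r; apply: ge_inf => //; split=> //; rewrite scaler0.
    exact: nbhs_singleton.
  have nc0 := normc_gt0 c0.
  rewrite -ler_pdivrMl//; apply: lb_le_inf => // s [s0 Ws].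
  rewrite ler_pdivrMl//; apply: ge_inf => //; split; first exact: mulr_gt0.
  (* Dividing [c *: x] by [Normc.normc c * s] multiplies [s^-1%:C *: x] by a scalar of modulus 1,
     which preserves [W]. *)
  rewrite invfM rmorphM mulrC scalerA mulrAC -mulrA mulrC -scalerA.
  apply: WZ => //; rewrite Normc.normcM normc_real gtr0_norm ?invr_gt0//.
  by rewrite mulfV ?gt_eqF.
exists p; split=> // [|x px].
  apply: continuous_seminorm => //.
  have h : 2^-1%:C != 0 :> R[i] by rewrite realC_neq0.
  (* On half of [W] the gauge is at most 1/2. *)
  apply: filterS (nbhs0Z h W0) => _ [x Wx <-] /=.
  apply: (@le_lt_trans _ _ 2^-1); last by lra.
  apply: ge_inf => //; split=> //.
  by rewrite scalerA -rmorphM mulVf ?scale1r// pnatr_eq0.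
have [s [s0 Ws] s1] := inf_lt (D0 x) px.
apply: UV; have := Ws s%:C; rewrite scalerA -rmorphM mulfV ?gt_eqF// scale1r.
by apply; rewrite normc_real gtr0_norm// ltW.
Qed.

End Gauge.

(** * Extension to completions *)

(** If [A] and [B] are neighbourhoods of [f x] and [g x], then [D] meets the interior of their
    common preimage, so [A] and [B] meet. *)
Lemma eq_on_dense (X Y : topologicalType) (D : set X) (f g : X -> Y) :
  hausdorff_space Y -> dense D -> continuous f -> continuous g ->
  (forall x, D x -> f x = g x) -> f =1 g.
Proof.
move=> hY dD fc gc fg x; suff: cluster (nbhs (f x)) (g x) by exact: hY.
move=> A B fA gB.
have /nbhs_interior : nbhs x (f @^-1` A `&` g @^-1` B).
  by apply: filterI; [exact: fc|exact: gc].
move=> /nbhs_singleton xI.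
have [y [/interior_subset[fAy gBy] Dy]] :=
  dD _ (ex_intro _ x xI) (open_interior _).
by exists (f y); split=> //; rewrite fg.
Qed.

Section CompletionExtension.
Variables (R : realType) (E : lmodType R[i]) (P : set (E -> R)).
Variables (X Y : clcsType R) (i : E -> X) (f : E -> Y).
Hypotheses (iP : is_completion P i) (fl : linear f).
Hypothesis f0 : forall V, nbhs 0 V -> seminorm_nbhs0 P (f @^-1` V).

Let il : linear i. Proof. by case: iP. Qed.

(** The neighbourhood filter of [x] pulled back to [E]; the extension at [x] is the limit of [f]
    along it. Density of the range of [i] makes it proper. *)
Let trace (x : X) : set_system E := filter_from (nbhs x) (fun U => i @^-1` U).

Let trace_proper (x : X) : ProperFilter (trace x).
Proof.
apply: filter_from_proper => [|U /nbhs_interior/nbhs_singleton xU].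
  apply: filter_from_filter; first by exists setT; exact: filterT.
  by move=> U V Ux Vx; exists (U `&` V) => //; exact: filterI.
have [_ di _] := iP; have [y [/interior_subset Uy [e _ ey]]] :=
  di _ (ex_intro _ x xU) (open_interior U).
by exists e; rewrite /= ey.
Qed.

Let near0 V : nbhs 0 V -> exists2 U, nbhs 0 U & i @^-1` U `<=` f @^-1` V.
Proof. by move=> V0; have [_ _ iU] := iP; apply/iU/f0. Qed.

Let near_trace (x : X) V : nbhs 0 V ->
  exists2 U, nbhs x U & forall a b, U (i a) -> U (i b) -> V (f (a - b)).
Proof.
move=> /near0[U U0 UV]; have := @sub_continuous X (x, x) U; rewrite /= subrr.
move=> /(_ U0)[[U1 U2] /= [U1x U2x] U12];
exists (U1 `&` U2); first exact: filterI.
move=> a b [U1a _] [_ U2b]; apply: UV => /=.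
rewrite -scaleN1r addrC il scaleN1r addrC; exact: (U12 (i a, i b)).
Qed.

Lemma completion_ext : exists g : X -> Y,
  [/\ linear g, continuous g & forall e, g (i e) = f e].
Proof.
have fB a b : f (a - b) = f a - f b.
  by rewrite -scaleN1r addrC fl scaleN1r addrC.
have /choice[g gP] x : exists y : Y, f @ trace x --> y.
  have tx := trace_proper x.
  apply: clcs_complete => V /(near_trace x)[U Ux UV].
  exists (f @` (i @^-1` U)); first by exists U => // a Ua; exists a.
  by move=> _ _ [a Ua <-] [b Ub <-]; rewrite -fB; exact: UV.
(* A limit of values in [W] lies in the closure of [W], hence [W] is taken with closure inside [V].
   Passing to the interior of [U] makes [U] a neighbourhood of each point [x] considered. *)
have unif V : nbhs 0 V -> exists2 U, nbhs 0 U & g @` U `<=` V.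
  move=> /uniform_regular[W W0 WV]; have [U U0 UW] := near0 W0.
  exists U^°; first exact: nbhs_interior.
  move=> _ [x Ux <-]; apply: WV => B gB.
  have tx := trace_proper x.
  have : (f @ trace x) (W `&` B).
    apply: filterI; last exact: gP.
    by exists U => //; move: Ux; exact: interior_subset.
  by move=> /filter_ex[y [Wy By]]; exists y.
have gl : linear g.
  move=> c x y; have tx := trace_proper x; have ty := trace_proper y.
  pose F := filter_prod (trace x) (trace y).
  (* Both sides are limits of [f (c *: a + b)] along the product of the traces at [x] and [y]. *)
  apply: (@cvg_unique _ clcs_hausdorff ((fun z => f (c *: z.1 + z.2)) @ F)).
    have h : (fun z => c *: z.1 + z.2) @ F --> trace (c *: x + y).
      move=> V [U Uxy UV].
      have [[U1 U2] /= [U1x U2y] U12] :=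
        @linear_combination_continuous _ X c (x, y) U Uxy.
      exists (i @^-1` U1, i @^-1` U2) => /=.
        by split; [exists U1|exists U2].
      move=> [a b] [/= U1a U2b]; apply: UV => /=; rewrite il.
      exact: (U12 (i a, i b)).
    apply: cvg_comp h (gP _).
  rewrite (_ : (fun z => f _) = (fun z => c *: f z.1 + f z.2)); last first.
    by apply/funext => z; exact: fl.
  have h : (fun z => (f z.1, f z.2)) @ F --> (g x, g y).
    apply: cvg_pair; [apply: cvg_comp (gP x)|apply: cvg_comp (gP y)].
      exact: cvg_fst.
    exact: cvg_snd.
  apply: cvg_comp h (@linear_combination_continuous _ Y c (g x, g y)).
exists g; split=> //.
  apply: continuous_linear0 => // V /unif[U U0 UV]; apply: filterS U0 => x Ux.
  by apply: UV; exists x.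
move=> e; have te := trace_proper (i e).
apply: (@cvg_unique _ clcs_hausdorff (f @ trace (i e))); first exact: gP.
move=> V /nbhs0_translate/(near_trace (i e))[U Ue UV].
exists U => // a Ua /=; have := UV a e Ua (nbhs_singleton Ue).
by rewrite /= fB addrC subrK.
Qed.

End CompletionExtension.

(** * Completed projective tensor products and jointly continuous bilinear maps *)

Section HatTensor.
Variables (R : realType) (E F X : clcsType R) (f : E -> F -> X).
Hypotheses (fb : bilin f) (fc : continuous (fun z : E * F => f z.1 z.2)).

Lemma tlift_nbhs0 V : nbhs 0 V ->
  seminorm_nbhs0 (@proj_seminorms R E F) (tlift f @^-1` V).
Proof.
move=> /nbhs0_seminorm[r [sr rc rV]].
have := @fc (0, 0) [set x | r x < 1]; rewrite /= (bilin0l fb).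
move=> /(_ (seminorm_nbhs sr rc ltr01))[[U1 U2] /= [U10 U20] U12].
have [p [sp pc pU]] := nbhs0_seminorm U10.
have [q [sq qc qU]] := nbhs0_seminorm U20.
(* The bound by 1 on the product of the unit balls of [p] and [q] is made homogeneous in one
   variable at a time. *)
have rpq x y : r (f x y) <= p x * q y.
  have sx : is_seminorm (r \o f x) by apply: seminorm_comp => //; exact: fb.2.
  rewrite -[p x]divr1; apply: (seminorm_le_ball sx sq ltr01) => y' qy /=.
  have sy : is_seminorm (r \o f^~ y').
    by apply: seminorm_comp => //; exact: fb.1.
  rewrite -[p x]mul1r -[1 in leRHS]divr1.
  apply: (seminorm_le_ball sy sp ltr01) => x' px /=.
  apply/ltW/(U12 (x', y')); split; [exact: pU|exact: qU].
exists 1, (fun=> proj_seminorm p q), 1; split=> // [_|u /= up].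
  by exists p, q; split.
apply: rV => /=; apply: le_lt_trans (up ord0).
by rewrite -[leRHS]mul1r; apply: le_proj_seminorm => // x y; rewrite mul1r.
Qed.

Lemma hat_tensor_ext (T : clcsType R) (t : E -> F -> T) : is_hat_tensor t ->
  exists g : T -> X,
    [/\ linear g, continuous g & forall x y, g (t x y) = f x y].
Proof.
move=> [tb tP].
have [g [gl gc gE]] := completion_ext tP (tlift_linear fb) tlift_nbhs0.
by exists g; split=> // x y; rewrite -(tlift_tens tb) gE (tlift_tens fb).
Qed.

(** [hat_lift] is a choice with default 0; since an extension exists, the chosen map has the
    required properties. *)
Lemma hat_liftP (T : clcsType R) (t : E -> F -> T) : is_hat_tensor t ->
  [/\ linear (hat_lift t f), continuous (hat_lift t f)
    & forall x y, hat_lift t f (t x y) = f x y].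
Proof. by move=> /hat_tensor_ext; apply: xgetPex. Qed.

End HatTensor.

Lemma continuous_compose (X Y Z : topologicalType) (f : X -> Y) (g : Y -> Z) :
  continuous f -> continuous g -> continuous (fun x => g (f x)).
Proof. by move=> fc gc x; apply: continuous_comp; [exact: fc|exact: gc]. Qed.

Lemma continuous_curry2 (X Y Z : topologicalType) (f : X -> Y -> Z) (x : X) :
  continuous (fun z : X * Y => f z.1 z.2) -> continuous (f x).
Proof.
move=> fc y; apply: (@continuous2_cvg _ X Y Z _ _ (fun=> x) id f).
- exact: (fc (x, y)).
- exact: cvg_cst.
- exact: cvg_id.
Qed.

Lemma continuous_curry1 (X Y Z : topologicalType) (f : X -> Y -> Z) (y : Y) :
  continuous (fun z : X * Y => f z.1 z.2) -> continuous (f^~ y).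
Proof.
move=> fc x; apply: (@continuous2_cvg _ X Y Z _ _ id (fun=> y) f).
- exact: (fc (x, y)).
- exact: cvg_id.
- exact: cvg_cst.
Qed.

Lemma continuous_comp2 (X Y Z T U : topologicalType) (h : X -> Y -> Z)
    (f : T -> X) (g : U -> Y) :
  continuous (fun z : X * Y => h z.1 z.2) -> continuous f -> continuous g ->
  continuous (fun z : T * U => h (f z.1) (g z.2)).
Proof.
move=> hc fc gc [x y].
apply: (@continuous2_cvg _ X Y Z _ _ (f \o fst) (g \o snd) h).
- exact: (hc (f x, g y)).
- exact: (@cvg_comp _ _ _ fst f _ (nbhs x) _ cvg_fst (fc x)).
- exact: (@cvg_comp _ _ _ snd g _ (nbhs y) _ cvg_snd (gc y)).
Qed.

Section BilinearContinuity.
Variable R : realType.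

(** The increment of [f] at [(x0, y0)] is [f x0 y + f x y0 + f x y]; each term is made smaller than
    1/3 for a seminorm [r] whose unit ball lies in the translated neighbourhood. *)
Lemma bilin_continuous0 (X Y Z : tvsType R[i]) (f : X -> Y -> Z) : bilin f ->
  (forall V, nbhs 0 V -> exists U1 U2, [/\ nbhs 0 U1, nbhs 0 U2
    & forall x y, U1 x -> U2 y -> V (f x y)]) ->
  continuous (fun z : X * Y => f z.1 z.2).
Proof.
move=> fb f0 [x0 y0] V /nbhs0_translate/nbhs0_seminorm[r [sr rc rV]].
have e0 : (0 : R) < 3^-1 by rewrite invr_gt0.
have [U1 [U2 [U10 U20 U12]]] := f0 _ (seminorm_nbhs sr rc e0).
(* As [U1] contains [x0 / s], the term [f x0 y] equals [f (x0 / s) (s y)], which is small for [y] in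
   [s^-1 U2]; likewise for [y0] and [d]. *)
have [s s0 Us] := nbhs0_absorbing x0 U10.
have [d d0 Ud] := nbhs0_absorbing y0 U20.
have W1 : nbhs 0 (U1 `&` *:%R d^-1%:C @` U1).
  by apply: filterI => //; apply: nbhs0Z => //; rewrite realC_neq0 ?invr_gt0.
have W2 : nbhs 0 (U2 `&` *:%R s^-1%:C @` U2).
  by apply: filterI => //; apply: nbhs0Z => //; rewrite realC_neq0 ?invr_gt0.
exists (+%R x0 @` (U1 `&` *:%R d^-1%:C @` U1),
        +%R y0 @` (U2 `&` *:%R s^-1%:C @` U2)).
  by split; exact: nbhsT.
move=> [_ _] /= [[x [U1x [x' U1x' xE]] <-] [y [U2y [y' U2y' yE]] <-]] /=.
rewrite (bilinDl fb) !(bilinDr fb) -addrA; apply: rV => /=.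
have h1 := U12 _ _ Us U2y'; have h2 := U12 _ _ U1x' Ud.
have h3 := U12 _ _ U1x U2y.
rewrite /= (bilinZl fb) -(bilinZr fb) yE in h1.
rewrite /= (bilinZr fb) -(bilinZl fb) xE in h2.
have := sr.1 (f x0 y) (f x y0 + f x y); have := sr.1 (f x y0) (f x y).
by move: h3 => /=; lra.
Qed.

(** A neighbourhood of 0 in [T] pulls back to one cut out by finitely many projective seminorms,
    each bounded by [p x * q y] on elementary tensors; requiring [p x < e] and [q y < 1]
    suffices. *)
Lemma hat_tensor_continuous (E F T : clcsType R) (t : E -> F -> T) :
  is_hat_tensor t -> continuous (fun z : E * F => t z.1 z.2).
Proof.
move=> [tb [_ _ tV]]; apply: bilin_continuous0 => // V V0.
have /tV[n [r [e [rP e0 rV]]]] : exists2 V', nbhs 0 V' &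
  tlift t @^-1` V' `<=` tlift t @^-1` V by exists V.
have /choice[p /choice[q pq]] : forall k, exists p, exists q,
    [/\ is_seminorm p, continuous p, is_seminorm q, continuous q
      & r k = proj_seminorm p q] by move=> k; exact: rP.
exists [set x | forall k, p k x < e], [set y | forall k, q k y < 1]; split.
- apply: filter_forall => k; have [sp pc _ _ _] := pq k; exact: seminorm_nbhs.
- apply: filter_forall => k; have [_ _ sq qc _] := pq k; exact: seminorm_nbhs.
move=> x y px qy; have /= := rV (tens x y); rewrite (tlift_tens tb); apply=> k.
have [sp _ sq _ ->] := pq k.
apply: le_lt_trans (proj_seminorm_tens sp sq x y) _.
rewrite (le_lt_trans _ (px k))// ler_piMr ?(seminorm_ge0 sp)//; exact/ltW/qy.
Qed.

Lemma completion_seminorm_le (E : lmodType R[i]) (P : set (E -> R))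
    (X : clcsType R) (i : E -> X) (p : X -> R) :
  P (fun=> 0) -> (forall p q, P p -> P q -> P (fun x => p x + q x)) ->
  P `<=` @is_seminorm R E -> is_completion P i ->
  is_seminorm p -> continuous p ->
  exists2 q, P q & exists2 C : R, 0 < C & forall x, p (i x) <= C * q x.
Proof.
move=> P0 PD Ps [il _ iV] sp pc.
have /iV : exists2 V, nbhs (0 : X) V & i @^-1` V `<=` i @^-1` [set x | p x < 1].
  by exists [set x | p x < 1] => //; exact: seminorm_nbhs.
move=> /(seminorm_nbhs0_single P0 PD Ps)[q Pq [e e0 qp]].
exists q => //; exists (1 / e) => [|x]; first by rewrite divr_gt0.
apply: (@seminorm_le_ball _ _ (p \o i)) => // [||y qy].
- exact: seminorm_comp.
- exact: Ps.
- exact/ltW/qp.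
Qed.

End BilinearContinuity.

(** * The canonical map of the smash products *)

Section SmashMap.
Variables (R : realType) (H : bialgType R[i]) (A : moduleAlgType H).
Variables (Hhat : hatBialgType R) (iH : H -> Hhat).
Variables (Atilde : hatModuleAlgType Hhat) (iA : A -> Atilde).
Variables (S : hatAlgType R) (t : Atilde -> Hhat -> S).
Hypotheses (HhatP : is_bialg_envelope iH) (AtildeP : is_H_completion iH iA).
Hypothesis SP : is_analytic_smash t.
Local Notation j := (@smash_map R H A Hhat iH Atilde iA S t).

Let tb : bilin t. Proof. by case: SP => -[]. Qed.
Let iAl : linear iA. Proof. by case: AtildeP => _ []. Qed.
Let iHl : linear iH. Proof. by case: HhatP => -[_ []]. Qed.

Lemma smash_map_bilin : bilin (fun a h => t (iA a) (iH h)).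
Proof.
split=> [h|a] c x y; first by rewrite iAl tb.1.
by rewrite iHl tb.2.
Qed.

Lemma smash_map_tens a h : j (tens a h) = t (iA a) (iH h).
Proof. exact: (tlift_tens smash_map_bilin). Qed.

Lemma smash_map_linear : linear j.
Proof. exact: (tlift_linear smash_map_bilin). Qed.

Lemma smash_map_nbhs0 V : nbhs 0 V ->
  seminorm_nbhs0 (@submult_seminorms R (smash A)) (j @^-1` V).
Proof.
move=> V0; have [[_ [_ _ tV]] _ _] := SP.
have ib : bilin (fun a h => tens (iA a) (iH h) : tensor Atilde Hhat).
  split=> [h|a] c x y; first by rewrite iAl (tens_bilin _ _).1.
  by rewrite iHl (tens_bilin _ _).2.
(* The map factors through the algebraic tensor product of [Atilde] and [Hhat], where projective
   seminorms define the topology induced from [S]. *)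
have -> : j @^-1` V =
    tlift (fun a h => tens (iA a) (iH h)) @^-1` (tlift t @^-1` V).
  congr (_ @^-1` V); apply/funext => u /=.
  rewrite (linear_tlift _ _ (tlift_linear tb)); apply: eq_tlift => a h.
  by rewrite (tlift_tens tb).
apply: (@seminorm_nbhs0_comp R (tensor Atilde Hhat) (smash A)
  (@proj_seminorms R Atilde Hhat)); last 2 first.
- by move=> r [].
- by apply/tV; exists V.
move=> _ [p [q [sp pc sq qc ->]]].
have [AC _ _] := AtildeP; have [[HC _] _ _] := HhatP.
have [p' Pp [C C0 pC]] := completion_seminorm_le
  (stable_submult_seminorms0 A) (@stable_submult_seminormsD _ _ A)
  (fun p '(And3 s _ _) => s) AC sp pc.
have [q' Pq [D D0 qD]] := completion_seminorm_le
  (submult_seminorms0 H) (@submult_seminormsD _ H)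
  (fun q => @proj1 _ _) HC sq qc.
have [r rS [M pM]] := proj_seminorm_le_submult Pp Pq.
(* [C] and [D] come from comparing [p] and [q] with seminorms on [A] and [H], and [M] from
   dominating their projective seminorm by [r]. *)
exists r => //; exists (C * D * M) => u.
have [sp' _ _] := Pp; have [sq' _] := Pq.
rewrite -mulrA;
apply: (@le_trans _ _ (C * D * proj_seminorm p' q' u)); last first.
  by rewrite mulrA -[leRHS]mulrA ler_wpM2l// ltW// mulr_gt0.
apply: le_proj_seminorm => //; first exact: proj_seminorm_seminorm.
  exact: mulr_gt0.
move=> a h; apply: le_trans (proj_seminorm_tens sp sq _ _) _.
by rewrite mulrACA ler_pM// seminorm_ge0.
Qed.

Lemma smash_map_morphism : alg_morphism j.
Proof.
have [_ [_ iA1 iAM] iAact] := AtildeP.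
have [[_ [_ iH1 iHM]] iHcomul _] := HhatP; have [_ t1 tM] := SP.
have jl := smash_map_linear; split=> //.
  by rewrite -[\1]/(tens \1 \1) smash_map_tens iA1 iH1.
move=> u v; move: u; apply: eq_linear_tens => [||a h].
- apply: (@linear_compose _ _ _ _ (fun u : smash A => u ** v)) => //.
  exact: amul_bilin.1.
- apply: (@linear_compose _ _ _ _ j (fun u => u ** j v)) => //.
  exact: amul_bilin.1.
move: v; apply: eq_linear_tens => [||b k].
- apply: (@linear_compose _ _ _ _ (amul (tens a h : smash A))) => //.
  exact: amul_bilin.2.
- by apply: (@linear_compose _ _ _ _ j) => //; exact: amul_bilin.2.
rewrite -[_ ** _ in LHS]/(smash_mul _ _) smash_mulE (linear_tlift _ _ jl).
rewrite !smash_map_tens tM iHcomul.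
(* [hcomul (iH h)] is a finite sum of elementary tensors, so the lift of [F] that defines the
   product of [S] is computed term by term. *)
pose F u v := t (iA a ** hhact u (iA b)) (v ** iH k).
have Fb : bilin F.
  split=> [v|u] c x y; rewrite /F.
    by rewrite (hhact_bilin.1 (iA b)) amul_linr tb.1.
  by rewrite amul_linl tb.2.
have Fc : continuous (fun z : Hhat * Hhat => F z.1 z.2).
  apply: (@continuous_comp2 _ _ _ _ _ t (fun u => iA a ** hhact u (iA b))
    (fun v => v ** iH k)).
  - by apply: hat_tensor_continuous; case: SP.
  - apply: (@continuous_compose _ _ _ (hhact^~ (iA b)) (amul (iA a))).
      exact: (continuous_curry1 hhact_continuous).
    exact: (continuous_curry2 amul_continuous).
  - exact: (continuous_curry1 amul_continuous).
have [Fl _ FE] := hat_liftP Fb Fc hsqP.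
rewrite (linear_tlift _ _ Fl); apply: eq_tlift => x y.
by rewrite smash_map_tens FE /F iAact iAM iHM.
Qed.

End SmashMap.

Theorem theorem2p2 (R : realType)
  (H : hopfType R[i]) (H_cocomm : cocommutative H)
  (A : moduleAlgType H)
  (Hhat : hatBialgType R) (iH : H -> Hhat) (HhatP : is_bialg_envelope iH)
  (Atilde : hatModuleAlgType Hhat) (iA : A -> Atilde)
  (AtildeP : is_H_completion iH iA)
  (S : hatAlgType R) (t : Atilde -> Hhat -> S) (SP : is_analytic_smash t)
  (E : hatAlgType R) (iE : smash A -> E) (EP : is_AM_envelope iE) :
  exists f : E -> S,
    hat_alg_iso f /\ forall u : smash A, f (iE u) = smash_map iH iA t u.
Proof.
have [EC [iEl iE1 iEM]] := EP; have [_ iEd iEV] := EC.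
have [AC _ _] := AtildeP; have [_ iAd _] := AC.
have [[HC _] _ _] := HhatP; have [_ iHd _] := HC.
have [tP _ _] := SP; have tc := hat_tensor_continuous tP.
have [tb [_ td _]] := tP.
have [jl j1 jM] := smash_map_morphism HhatP AtildeP SP.
have [f [fl fc fE]] := completion_ext EC jl (smash_map_nbhs0 HhatP AtildeP SP).
have iE0 V : nbhs 0 V ->
    seminorm_nbhs0 (@submult_seminorms R (smash A)) (iE @^-1` V).
  by move=> V0; apply/iEV; exists V.
have [inl_l _ _] := smash_inl_morphism A.
have [inr_l _ _] := smash_inr_morphism A.
have [|alpha [al ac aE]] := completion_ext AC (linear_compose inl_l iEl).
  move=> V /iE0; apply: seminorm_nbhs0_comp => [p pS|p []//].
  exists (p \o @smash_inl R H A); first exact: smash_inl_stable.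
  by exists 1 => x; rewrite mul1r.
have [|beta [bl bc bE]] := completion_ext HC (linear_compose inr_l iEl).
  move=> V /iE0; apply: seminorm_nbhs0_comp => [p pS|p []//].
  exists (p \o smash_inr A); last by exists 1 => x; rewrite mul1r.
  by apply: submult_seminorms_comp => //; exact: smash_inr_morphism.
have abb : bilin (fun x y => alpha x ** beta y).
  by split=> [y|x] c u v; rewrite ?al ?bl ?amul_linl ?amul_linr.
have abc : continuous (fun z : Atilde * Hhat => alpha z.1 ** beta z.2).
  exact: (continuous_comp2 amul_continuous).
have [g [gl gc gE]] := hat_tensor_ext abb abc tP.
have ab a h : alpha (iA a) ** beta (iH h) = iE (tens a h).
  by rewrite aE bE /= -iEM smash_inl_inr.
have jE a h := smash_map_tens HhatP AtildeP SP a h.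
(* Checked on the images of [A] and [H], then extended by density in each variable separately. *)
have fab x y : f (alpha x ** beta y) = t x y.
  move: x; apply: (eq_on_dense clcs_hausdorff iAd) => [||_ [a _ <-]].
  - apply: (@continuous_compose _ _ _ (fun x => alpha x ** beta y) f) => //.
    exact: (@continuous_curry1 _ _ _ (fun x y => alpha x ** beta y) y abc).
  - exact: (@continuous_curry1 _ _ _ t y tc).
  move: y; apply: (eq_on_dense clcs_hausdorff iHd) => [||_ [h _ <-]].
  - apply: (@continuous_compose _ _ _ (fun y => alpha _ ** beta y) f) => //.
    exact: (@continuous_curry2 _ _ _ (fun x y => alpha x ** beta y) _ abc).
  - exact: (@continuous_curry2 _ _ _ t _ tc).
  by rewrite ab fE jE.
have gj : g \o smash_map iH iA t =1 iE.
  apply: eq_linear_tens => [||a h] //; first exact: linear_compose.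
  by rewrite /= jE gE ab.
have fg : cancel f g.
  apply: (eq_on_dense clcs_hausdorff iEd) => [||_ [u _ <-]].
  - by apply: (@continuous_compose _ _ _ f g).
  - by move=> x; exact: cvg_id.
  - by rewrite fE; exact: gj.
have gf : cancel g f.
  apply: (eq_on_dense clcs_hausdorff td) => [||_ [w _ <-]].
  - by apply: (@continuous_compose _ _ _ g f).
  - by move=> x; exact: cvg_id.
  (* On the dense algebraic tensors, linearity reduces [f \o g = id] to elementary tensors, where it
     is [fab]. *)
  move: w; apply: eq_linear_tens => [||x y].
  - apply: (@linear_compose _ _ _ _ (g \o tlift t)) fl.
    apply: linear_compose gl; exact: tlift_linear.
  - exact: tlift_linear.
  by rewrite (tlift_tens tb) gE fab.
exists f; split=> //; split; last by exists g.
  split=> //; first by rewrite -iE1 fE j1.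
  (* Multiplicativity passes from [smash A] to [E] by density, one factor at a time. *)
  move=> x y; move: x.
  apply: (eq_on_dense clcs_hausdorff iEd) => [||_ [u _ <-]].
  - apply: (@continuous_compose _ _ _ (amul^~ y) f) => //.
    exact: (continuous_curry1 amul_continuous).
  - apply: (@continuous_compose _ _ _ f (amul^~ (f y))) => //.
    exact: (continuous_curry1 amul_continuous).
  move: y; apply: (eq_on_dense clcs_hausdorff iEd) => [||_ [v _ <-]].
  - apply: (@continuous_compose _ _ _ (amul (iE u)) f) => //.
    exact: (continuous_curry2 amul_continuous).
  - apply: (@continuous_compose _ _ _ f (amul (f (iE u)))) => //.
    exact: (continuous_curry2 amul_continuous).
  by rewrite -iEM !fE jM.
by [].
Qed.
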